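(* Let $(A,\mathfrak{m})$ be a Henselian commutative Noetherian local ring. Let $X \in K^b(\operatorname{proj} A)$. If there is in $K^b(\operatorname{proj} A)$ a right AR-triangle ending at $X$, or a left AR-triangle ending at $X$, then $H^*(X)$ has finite length.
   Context: $K^b(\operatorname{proj} A)$ is the homotopy category of bounded (cochain) complexes of finitely generated free $A$-modules; it is a Krull-Schmidt triangulated category when $A$ is Henselian. $H^*(X)=\bigoplus_i H^i(X)$. A triangle $N \xrightarrow{f} E \xrightarrow{g} M \xrightarrow{h} N[1]$ in a Krull-Schmidt triangulated category is a right AR-triangle ending at $M$ if $M,N$ are indecomposable, $h \neq 0$, and for every indecomposable $D$ and every non-isomorphism $t\colon D \to M$ we have $h\circ t = 0$. A triangle $M[-1] \xrightarrow{w} N \xrightarrow{f} E \xrightarrow{g} M$ is a left AR-triangle (starting at $N$ and ending at $M$) if $M,N$ are indecomposable, $w\neq 0$, and for every indecomposable $D$ and every non-isomorphism $t\colon N\to D$ we have $t\circ w=0$. *)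

(* Defs.v *)
From HB Require Import structures.
From mathcomp Require Import all_boot all_order all_algebra.
From mathcomp Require Import boolp classical_sets.
From mathcomp Require Import zify.

Set Implicit Arguments.
Unset Strict Implicit.
Unset Printing Implicit Defensive.

Import GRing.Theory.
Local Open Scope classical_set_scope.
Local Open Scope ring_scope.

Section CommutativeAlgebra.
Variable A : comNzRingType.

Definition submodule (V : lmodType A) (P : set V) : Prop :=
  P 0 /\ forall (a : A) u v, P u -> P v -> P (a *: u + v).

Definition ideal (I : set A) : Prop := @submodule A^o I.

Definition maximal_ideal (I : set A) : Prop :=
  [/\ ideal I, ~ I 1 & forall J, ideal J -> I `<=` J -> ~ J 1 -> J = I].

Definition local_ring (m : set A) : Prop :=
  maximal_ideal m /\ forall m', maximal_ideal m' -> m' = m.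

Definition noetherian : Prop :=
  forall I, ideal I -> exists s : seq A,
    forall x, I x <-> exists c : nat -> A, x = \sum_(i < size s) c i * s`_i.

(* The residue field A/m is given as a field k with a surjective ring morphism
   A -> k of kernel m. *)
Definition henselian (m : set A) : Prop :=
  exists (k : fieldType) (pi : {rmorphism A -> k}),
    [/\ forall y, exists x, pi x = y,
        forall x, pi x = 0 <-> m x
      & forall (f : {poly A}) (g0 h0 : {poly k}),
          f \is monic -> g0 \is monic -> h0 \is monic -> coprimep g0 h0 ->
          map_poly pi f = g0 * h0 ->
          exists g h : {poly A},
            [/\ g \is monic, h \is monic, f = g * h,
                map_poly pi g = g0 & map_poly pi h = h0]].

(* A composition series 0 = L 0 < L 1 < ... < L n = V, the simplicity of
   L i.+1 / L i being expressed by the absence of intermediate submodules. *)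
Definition finite_length (V : lmodType A) : Prop :=
  exists (n : nat) (L : nat -> set V),
    [/\ forall i, (i <= n)%N -> submodule (L i), L 0%N = [set 0], L n = setT
      & forall i, (i < n)%N ->
          L i `<` L i.+1 /\
          forall P, submodule P -> L i `<=` P -> P `<=` L i.+1 ->
            P = L i \/ P = L i.+1].

End CommutativeAlgebra.

Section QuotientModule.
Variables (A : comNzRingType) (V : lmodType A).
Variables (S : {pred V}) (S_closed : submod_closed S).

Definition quot_pred of submod_closed S : {pred V} := S.

HB.instance Definition _ := GRing.isSubmodClosed.Build A V
  (quot_pred S_closed) S_closed.

Definition quotmod := Quotient.quot (quot_pred S_closed).

HB.instance Definition _ := Choice.on quotmod.
HB.instance Definition _ := GRing.Zmodule.on quotmod.

Definition to_quot (v : V) : quotmod :=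
  (\pi_(Quotient.quot (quot_pred S_closed)) v)%qT.

Definition of_quot (x : quotmod) : V :=
  @repr _ (Quotient.quot (quot_pred S_closed)) x.

Lemma of_quotK : cancel of_quot to_quot.
Proof. exact: reprK. Qed.

Lemma to_quot_eq u v : to_quot u = to_quot v <-> u - v \in S.
Proof.
by split=> [/eqP|uv]; [|apply/eqP];
  rewrite -[_ == _](Quotient.idealrBE (quot_pred S_closed)).
Qed.

Lemma to_quotD u v : to_quot (u + v) = to_quot u + to_quot v.
Proof. exact: (raddfD (\pi_(Quotient.quot (quot_pred S_closed)))%qT). Qed.

Definition quotmod_scale (a : A) (x : quotmod) : quotmod :=
  to_quot (a *: of_quot x).

Lemma quotmod_scaleE a v : quotmod_scale a (to_quot v) = to_quot (a *: v).
Proof.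
apply/to_quot_eq; rewrite -scalerBr.
by apply: (@rpredZ _ _ (quot_pred S_closed)); apply/to_quot_eq/of_quotK.
Qed.

Fact quotmod_scaleA a b x :
  quotmod_scale a (quotmod_scale b x) = quotmod_scale (a * b) x.
Proof. by rewrite -[x]of_quotK !quotmod_scaleE scalerA. Qed.

Fact quotmod_scale1 : left_id 1 quotmod_scale.
Proof. by move=> x; rewrite -[x]of_quotK quotmod_scaleE scale1r. Qed.

Fact quotmod_scaleDr : right_distributive quotmod_scale +%R.
Proof.
move=> a x y; rewrite -[x]of_quotK -[y]of_quotK.
by rewrite -to_quotD !quotmod_scaleE scalerDr to_quotD.
Qed.

Fact quotmod_scaleDl x : {morph quotmod_scale^~ x : a b / a + b}.
Proof.
by move=> a b; rewrite -[x]of_quotK !quotmod_scaleE scalerDl to_quotD.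
Qed.

HB.instance Definition _ := GRing.Zmodule_isLmodule.Build A quotmod
  quotmod_scaleA quotmod_scale1 quotmod_scaleDr quotmod_scaleDl.

End QuotientModule.

Section DirectSum.
Variables (A : comNzRingType) (I : choiceType) (V : I -> lmodType A).

Definition family := forall i, V i.

HB.instance Definition _ := gen_eqMixin family.
HB.instance Definition _ := gen_choiceMixin family.

Fact family_addA : associative (fun x y : family => (fun i => x i + y i) : family).
Proof. by move=> x y z; apply: functional_extensionality_dep => i; rewrite addrA. Qed.
Fact family_addC : commutative (fun x y : family => (fun i => x i + y i) : family).
Proof. by move=> x y; apply: functional_extensionality_dep => i; rewrite addrC. Qed.
Fact family_add0 :
  left_id (fun i => 0 : V i) (fun x y : family => (fun i => x i + y i) : family).
Proof. by move=> x; apply: functional_extensionality_dep => i; rewrite add0r. Qed.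
Fact family_addN :
  left_inverse (fun i => 0 : V i) (fun x : family => (fun i => - x i) : family)
    (fun x y : family => (fun i => x i + y i) : family).
Proof. by move=> x; apply: functional_extensionality_dep => i; rewrite addNr. Qed.

HB.instance Definition _ := GRing.isZmodule.Build family
  family_addA family_addC family_add0 family_addN.

Definition family_scale (a : A) (x : family) : family := fun i => a *: x i.

Fact family_scaleA a b x :
  family_scale a (family_scale b x) = family_scale (a * b) x.
Proof. by apply: functional_extensionality_dep => i; rewrite /family_scale scalerA. Qed.
Fact family_scale1 : left_id 1 family_scale.
Proof. by move=> x; apply: functional_extensionality_dep => i; rewrite /family_scale scale1r. Qed.
Fact family_scaleDr : right_distributive family_scale +%R.
Proof. by move=> a x y; apply: functional_extensionality_dep => i; exact: scalerDr. Qed.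
Fact family_scaleDl x : {morph family_scale^~ x : a b / a + b}.
Proof. by move=> a b; apply: functional_extensionality_dep => i; exact: scalerDl. Qed.

HB.instance Definition _ := GRing.Zmodule_isLmodule.Build A family
  family_scaleA family_scale1 family_scaleDr family_scaleDl.

Definition finitely_supported : {pred family} :=
  fun x => `[< exists s : seq I, forall i, i \notin s -> x i = 0 >].

Fact finitely_supported_closed : submod_closed finitely_supported.
Proof.
split; first by apply/asboolP; exists [::].
move=> a x y /asboolP[s xs] /asboolP[t yt]; apply/asboolP; exists (s ++ t) => i.
rewrite mem_cat negb_or => /andP[/xs xi /yt yi].
by rewrite -[LHS]/(a *: x i + y i) xi yi scaler0 addr0.
Qed.

HB.instance Definition _ := GRing.isSubmodClosed.Build A family
  finitely_supported finitely_supported_closed.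

Definition direct_sum := {x : family | finitely_supported x}.

HB.instance Definition _ := SubType.on direct_sum.
HB.instance Definition _ := Choice.on direct_sum.
HB.instance Definition _ := [SubChoice_isSubLmodule of direct_sum by <:].

End DirectSum.

(* A finitely generated free module is A^n, acted on by matrices on the right:
   the matrix of g \o f is f *m g. The differential is a family of matrices
   d i j : X^i -> X^j that vanishes unless j = i + 1, so that shifting needs no
   transport along equalities of degrees. *)
Record complex (A : comNzRingType) := Complex {
  rk :> int -> nat;
  diff : forall i j, 'M[A]_(rk i, rk j);
  diff_shape : forall i j, j != i + 1 -> diff i j = 0;
  diffK : forall i j k, diff i j *m diff j k = 0;
  bounded : exists b : nat, forall i : int, (b < `|i|)%N -> rk i = 0%N
}.

Record chain_map (A : comNzRingType) (X Y : complex A) := ChainMap {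
  cmap :> forall i, 'M[A]_(X i, Y i);
  cmapP : forall i j, cmap i *m diff Y i j = diff X i j *m cmap j
}.

Section HomotopyCategory.
Variable A : comNzRingType.
Implicit Types X Y Z : complex A.

(* Equality of morphisms in K^b(proj A); only the entries s i (i - 1) of s
   matter. *)
Definition homotopic X Y (f g : chain_map X Y) : Prop :=
  exists s : forall i j, 'M[A]_(X i, Y j), forall i,
    f i - g i = diff X i (i + 1) *m s (i + 1) i
                + s i (i - 1) *m diff Y (i - 1) i.

Fact cmap_id_subproof X i j :
  1%:M *m diff X i j = diff X i j *m 1%:M.
Proof. by rewrite mul1mx mulmx1. Qed.
Definition cmap_id X : chain_map X X := ChainMap (@cmap_id_subproof X).

Fact cmap_zero_subproof X Y i j :
  (0 : 'M_(X i, Y i)) *m diff Y i j = diff X i j *m 0.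
Proof. by rewrite mul0mx mulmx0. Qed.
Definition cmap_zero X Y : chain_map X Y := ChainMap (@cmap_zero_subproof X Y).

Fact cmap_comp_subproof X Y Z (g : chain_map Y Z) (f : chain_map X Y) i j :
  (f i *m g i) *m diff Z i j = diff X i j *m (f j *m g j).
Proof. by rewrite -mulmxA cmapP mulmxA cmapP mulmxA. Qed.
Definition cmap_comp X Y Z (g : chain_map Y Z) (f : chain_map X Y) :
  chain_map X Z := ChainMap (@cmap_comp_subproof X Y Z g f).

Definition is_iso X Y (f : chain_map X Y) : Prop :=
  exists g : chain_map Y X,
    homotopic (cmap_comp g f) (cmap_id X) /\
    homotopic (cmap_comp f g) (cmap_id Y).

Definition isomorphic X Y : Prop := exists f : chain_map X Y, is_iso f.

Fact zero_complex_bounded :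
  exists b : nat, forall i : int, (b < `|i|)%N -> 0%N = 0%N.
Proof. by exists 0%N. Qed.
Definition zero_complex : complex A :=
  @Complex A (fun=> 0%N) (fun i j => 0) (fun i j _ => erefl)
    (fun i j k => mul0mx _ 0) zero_complex_bounded.

Section Sum.
Variables X Y : complex A.

Definition sum_diff i j : 'M[A]_(X i + Y i, X j + Y j) :=
  block_mx (diff X i j) 0 0 (diff Y i j).

Fact sum_diff_shape i j : j != i + 1 -> sum_diff i j = 0.
Proof. by move=> ij; rewrite /sum_diff !diff_shape // block_mx0. Qed.

Fact sum_diffK i j k : sum_diff i j *m sum_diff j k = 0.
Proof.
by rewrite mulmx_block !(mulmx0, mul0mx) !diffK !addr0 block_mx0.
Qed.

Fact sum_bounded :
  exists b : nat, forall i : int, (b < `|i|)%N -> (X i + Y i = 0)%N.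
Proof.
have [[b Xb] [c Yc]] := (bounded X, bounded Y).
by exists (maxn b c) => i; rewrite gtn_max => /andP[/Xb-> /Yc->].
Qed.

Definition sum_complex : complex A :=
  Complex sum_diff_shape sum_diffK sum_bounded.

End Sum.

Definition indecomposable X : Prop :=
  ~ isomorphic X zero_complex /\
  forall Y Z, isomorphic X (sum_complex Y Z) ->
    isomorphic Y zero_complex \/ isomorphic Z zero_complex.

Section Shift.
Variables (n : int).

Definition shift_diff X i j : 'M[A]_(X (i + n), X (j + n)) :=
  (-1) ^+ `|n|%N *: diff X (i + n) (j + n).

Fact shift_diff_shape X i j : j != i + 1 -> shift_diff X i j = 0.
Proof.
move=> ij; rewrite /shift_diff diff_shape ?scaler0 //.
by rewrite addrAC (inj_eq (addIr n)).
Qed.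

Fact shift_diffK X i j k : shift_diff X i j *m shift_diff X j k = 0.
Proof. by rewrite -scalemxAl -scalemxAr diffK !scaler0. Qed.

Fact shift_bounded X :
  exists b : nat, forall i : int, (b < `|i|)%N -> X (i + n) = 0%N.
Proof.
have [b Xb] := bounded X; exists (b + `|n|)%N => i ib; apply: Xb.
by move: ib; lia.
Qed.

Definition shift X : complex A :=
  Complex (@shift_diff_shape X) (@shift_diffK X) (shift_bounded X).

Fact shift_map_subproof X Y (f : chain_map X Y) i j :
  f (i + n) *m diff (shift Y) i j = diff (shift X) i j *m f (j + n).
Proof. by rewrite -scalemxAr cmapP -scalemxAl. Qed.
Definition shift_map X Y (f : chain_map X Y) :
  chain_map (shift X) (shift Y) :=
  @ChainMap _ (shift X) (shift Y) (fun i => f (i + n)) (@shift_map_subproof X Y f).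

End Shift.

(* The identity matrix X^i -> X^j if i = j, and 0 otherwise. *)
Definition transport X i j : 'M[A]_(X i, X j) :=
  \matrix_(a, b) ((i == j) && (a == b :> nat))%:R.

Lemma transport_id X i : transport X i i = 1%:M.
Proof. by apply/matrixP => a b; rewrite !mxE eqxx. Qed.

Lemma transport_neq X i j : i != j -> transport X i j = 0.
Proof. by move=> /negPf ij; apply/matrixP => a b; rewrite !mxE ij. Qed.

Fact unshift_subproof X i j :
  transport X i (i + 1 + -1) *m diff (shift 1 (shift (-1) X)) i j =
  diff X i j *m transport X j (j + 1 + -1).
Proof.
rewrite /= /shift_diff /= /shift_diff !expr1 scalerA mulrNN mulr1 scale1r.
by rewrite !addrK !transport_id mul1mx mulmx1.
Qed.
(* The identification X = X[-1][1]. *)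
Definition unshift X : chain_map X (shift 1 (shift (-1) X)) :=
  @ChainMap _ X (shift 1 (shift (-1) X)) (fun i => transport X i (i + 1 + -1))
    (@unshift_subproof X).

Section Cone.
Variables (X Y : complex A) (f : chain_map X Y).

Definition cone_diff i j : 'M[A]_(X (i + 1) + Y i, X (j + 1) + Y j) :=
  block_mx (- diff X (i + 1) (j + 1)) (f (i + 1) *m transport Y (i + 1) j)
           0 (diff Y i j).

Fact cone_diff_shape i j : j != i + 1 -> cone_diff i j = 0.
Proof.
move=> ij; rewrite /cone_diff !diff_shape ?(inj_eq (addIr 1)) //.
by rewrite transport_neq 1?eq_sym // oppr0 mulmx0 block_mx0.
Qed.

Fact cone_diffK i j k : cone_diff i j *m cone_diff j k = 0.
Proof.
have [->|ij] := eqVneq j (i + 1); last by rewrite cone_diff_shape // mul0mx.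
have [->|jk] := eqVneq k (i + 1 + 1);
  last by rewrite [cone_diff _ k]cone_diff_shape // mulmx0.
rewrite mulmx_block !(mulmx0, mul0mx, addr0, add0r) mulNmx mulmxN opprK !diffK.
by rewrite !transport_id !mulmx1 mulNmx cmapP addNr block_mx0.
Qed.

Fact cone_bounded :
  exists b : nat, forall i : int, (b < `|i|)%N -> (X (i + 1)%R + Y i = 0)%N.
Proof.
have [[b Xb] [c Yc]] := (shift_bounded 1 X, bounded Y).
by exists (maxn b c) => i; rewrite gtn_max => /andP[/Xb-> /Yc->].
Qed.

Definition cone : complex A := Complex cone_diff_shape cone_diffK cone_bounded.

Fact cone_inj_subproof i j :
  (row_mx 0 1%:M : 'M_(Y i, X (i + 1) + Y i)) *m diff cone i j =
  diff Y i j *m row_mx 0 1%:M.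
Proof.
by rewrite /= /cone_diff mul_row_block mul_mx_row
           !(mulmx0, mul0mx, mulmx1, mul1mx, addr0, add0r).
Qed.
Definition cone_inj : chain_map Y cone :=
  @ChainMap _ Y cone (fun i => row_mx 0 1%:M) cone_inj_subproof.

Fact cone_proj_subproof i j :
  (col_mx 1%:M 0 : 'M_(X (i + 1) + Y i, X (i + 1))) *m diff (shift 1 X) i j =
  diff cone i j *m col_mx 1%:M 0.
Proof.
rewrite /= /shift_diff /cone_diff mul_block_col mul_col_mx.
by rewrite !(mulmx0, mul0mx, mulmx1, mul1mx, addr0) expr1 scaleN1r.
Qed.
Definition cone_proj : chain_map cone (shift 1 X) :=
  @ChainMap _ cone (shift 1 X) (fun i => col_mx 1%:M 0) cone_proj_subproof.

End Cone.

(* X -f-> Y -g-> Z -h-> X[1] is isomorphic in K^b(proj A) to the triangle of a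
   mapping cone. *)
Definition triangle X Y Z (f : chain_map X Y) (g : chain_map Y Z)
    (h : chain_map Z (shift 1 X)) : Prop :=
  exists (X' Y' : complex A) (u : chain_map X' Y') (a : chain_map X X')
         (b : chain_map Y Y') (c : chain_map Z (cone u)),
    [/\ is_iso a, is_iso b & is_iso c] /\
    [/\ homotopic (cmap_comp b f) (cmap_comp u a),
        homotopic (cmap_comp c g) (cmap_comp (cone_inj u) b)
      & homotopic (cmap_comp (shift_map 1 a) h) (cmap_comp (cone_proj u) c)].

Definition right_AR_triangle N E M (f : chain_map N E) (g : chain_map E M)
    (h : chain_map M (shift 1 N)) : Prop :=
  [/\ triangle f g h, indecomposable M, indecomposable N,
      ~ homotopic h (cmap_zero _ _)
    & forall D (t : chain_map D M), indecomposable D -> ~ is_iso t ->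
        homotopic (cmap_comp h t) (cmap_zero _ _)].

(* M[-1] -w-> N -f-> E -g-> M *)
Definition left_AR_triangle N E M (w : chain_map (shift (-1) M) N)
    (f : chain_map N E) (g : chain_map E M) : Prop :=
  [/\ triangle w f (cmap_comp (unshift M) g), indecomposable M,
      indecomposable N, ~ homotopic w (cmap_zero _ _)
    & forall D (t : chain_map N D), indecomposable D -> ~ is_iso t ->
        homotopic (cmap_comp t w) (cmap_zero _ _)].

End HomotopyCategory.

Section Cohomology.
Variables (A : comNzRingType) (X : complex A).

Section Degree.
Variable i : int.

Definition cocycle : {pred 'rV[A]_(X i)} :=
  fun v => v *m diff X i (i + 1) == 0.

Fact cocycle_closed : submod_closed cocycle.
Proof.
split; first by rewrite unfold_in mul0mx.
move=> a u v /eqP u0 /eqP v0.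
by rewrite unfold_in mulmxDl -scalemxAl u0 v0 scaler0 addr0.
Qed.

HB.instance Definition _ := GRing.isSubmodClosed.Build A 'rV[A]_(X i)
  cocycle cocycle_closed.

Definition cocycles := {v : 'rV[A]_(X i) | cocycle v}.

HB.instance Definition _ := SubType.on cocycles.
HB.instance Definition _ := Choice.on cocycles.
HB.instance Definition _ := [SubChoice_isSubLmodule of cocycles by <:].

Definition coboundary : {pred cocycles} :=
  fun v => `[< exists u : 'rV[A]_(X (i - 1)), \val v = u *m diff X (i - 1) i >].

Fact coboundary_closed : submod_closed coboundary.
Proof.
split; first by apply/asboolP; exists 0; rewrite mul0mx raddf0.
move=> a v w /asboolP[x vx] /asboolP[y wy]; apply/asboolP; exists (a *: x + y).
by rewrite linearP /= vx wy mulmxDl scalemxAl.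
Qed.

Definition cohomology : lmodType A := quotmod coboundary_closed.

End Degree.

Definition total_cohomology : lmodType A := direct_sum cohomology.

End Cohomology.

(* Main.v *)
(* For a in m, let t : Y -> X be the fiber of multiplication by a^n on X.
   If Y, a sum of indecomposables, has no summand mapped isomorphically to X by
   t, then h t = 0, so that h is a multiple of a^n. By Krull's intersection
   theorem this fails for some n, as h <> 0; then t splits and a^n = 0 on X.
   Thus every element of m has a power that kills H^*(X), a Noetherian module,
   which forces finite length.
   For a left triangle w : X[-1] -> N, take the fiber s : Y -> X[-1] of a^n. For
   some n, w s <> 0, and N is not a summand of the cone of w s, hence w dies in
   that cone and w = w s r for some r. The endomorphism e = s r satisfies
   w e = w and a^n e = 0. As A is Henselian and X indecomposable, e is either
   invertible, and then a^n = 0 on X, or nilpotent modulo m, and then w = 0.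
   Decompositions exist because dim H^*(Y (x) A/m) is additive and vanishes only
   on contractible complexes. *)
Require Import Defs.
From mathcomp Require Import all_boot all_order all_algebra.
From mathcomp Require Import boolp classical_sets.
From mathcomp Require Import zify.

Set Implicit Arguments.
Unset Strict Implicit.
Unset Printing Implicit Defensive.

Import GRing.Theory.
Local Open Scope classical_set_scope.
Local Open Scope ring_scope.

(** * Units of a local ring and matrices invertible modulo the maximal ideal *)

Section LocalRing.
Variables (A : comNzRingType) (m : set A) (A_local : local_ring m).

(** Zorn's lemma, applied to the proper ideals through a non-unit [a], gives a maximal ideal, which
    is [m] by uniqueness. *)
Lemma local_ring_unit a : ~ m a -> exists b, a * b = 1.
Proof.
move=> ma; apply: contrapT => a_nunit; apply: ma.
pose P J := J = set0 \/ [/\ ideal J, J a & ~ J 1].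
have [F FP Ftot|B [PB Bmax]] := @Zorn_bigcup A P.
  have [[J0 [FJ0 J0a]]|noa] := EM (exists J, F J /\ J a); last first.
    left; apply/seteqP; split=> // x [J FJ Jx].
    by case: (FP J FJ) Jx => [->//|[_ Ja _]]; case: noa; exists J.
  have prop J x : F J -> J x -> [/\ ideal J, J a & ~ J 1].
    by move=> FJ Jx; case: (FP J FJ) => // J0'; move: Jx; rewrite J0'.
  right; split; last first.
  - by move=> [J FJ J1]; have [_ _] := prop _ _ FJ J1; exact.
  - by exists J0.
  split; first by exists J0 => //; have [[]] := prop _ _ FJ0 J0a.
  move=> c u v [J FJ Ju] [K FK Kv].
  have [JK|KJ] := Ftot _ _ FJ FK.
    by exists K => //; have [[_ h] _ _] := prop _ _ FK Kv; apply: h => //; apply: JK.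
  by exists J => //; have [[_ h] _ _] := prop _ _ FJ Ju; apply: h => //; apply: KJ.
have Pa : P [set x | exists b, x = a * b].
  right; split; last by move=> [b ab]; apply: a_nunit; exists b.
    split; first by exists 0; rewrite mulr0.
    move=> c _ _ [b ->] [b' ->]; exists (c * b + b').
    by rewrite mulrDr mulrCA.
  by exists 1; rewrite mulr1.
case: PB => [B0|[Bid Ba B1]].
  case: (Bmax _ _ Pa); rewrite B0; split=> // h.
  by apply: (h a); exists 1; rewrite mulr1.
case: A_local => _ m_uniq.
rewrite -(m_uniq B) //; split=> // J Jid BJ J1.
apply: contrapT => JB; apply: (Bmax J); last by right; split=> //; exact: BJ.
by split=> // JB'; apply: JB; apply/seteqP.
Qed.

Section Residue.
Variables (k : fieldType) (pi : {rmorphism A -> k}).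
Hypothesis pi_m : forall x, pi x = 0 <-> m x.

Lemma unit_residue a : pi a != 0 -> exists b, a * b = 1.
Proof. by move=> a0; apply: local_ring_unit => /pi_m/eqP; apply/negP. Qed.

(** The determinant is 1 modulo [m], hence a unit, and the adjugate provides the inverse. *)
Lemma invertible_residue n (M : 'M[A]_n) : map_mx pi M = 1%:M ->
  exists N, M *m N = 1%:M /\ N *m M = 1%:M.
Proof.
move=> M1; have [|b Mb] := @unit_residue (\det M).
  by rewrite -det_map_mx M1 det1 oner_neq0.
exists (b *: \adj M); rewrite -scalemxAr -scalemxAl mul_mx_adj mul_adj_mx.
by rewrite scale_scalar_mx mulrC Mb.
Qed.

End Residue.
End LocalRing.

(** * Null-homotopic families and contractible complexes *)

Section Null.
Variable A : comNzRingType.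
Implicit Types W X Y Z : complex A.

(* [homotopic f g] is, by conversion, the nullity of [fun i => f i - g i]. *)
Definition null X Y (F : forall i, 'M[A]_(X i, Y i)) : Prop :=
  exists s : forall i j, 'M[A]_(X i, Y j), forall i,
    F i = diff X i (i + 1) *m s (i + 1) i + s i (i - 1) *m diff Y (i - 1) i.

Lemma eq_null X Y (F G : forall i, 'M[A]_(X i, Y i)) :
  (forall i, F i = G i) -> null F -> null G.
Proof. by move=> FG [s Fs]; exists s => i; rewrite -FG. Qed.

Lemma homotopic0 X Y (f : chain_map X Y) :
  homotopic f (cmap_zero X Y) <-> null f.
Proof. by split; apply: eq_null => i; rewrite subr0. Qed.

Lemma null0 X Y : null (fun i => 0 : 'M[A]_(X i, Y i)).
Proof. by exists (fun i j => 0) => i; rewrite mulmx0 mul0mx addr0. Qed.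

Lemma nullD X Y (F G : forall i, 'M[A]_(X i, Y i)) :
  null F -> null G -> null (fun i => F i + G i).
Proof.
move=> [s Fs] [t Gt]; exists (fun i j => s i j + t i j) => i.
by rewrite Fs Gt mulmxDr mulmxDl addrACA.
Qed.

Lemma nullZ X Y a (F : forall i, 'M[A]_(X i, Y i)) :
  null F -> null (fun i => a *: F i).
Proof.
move=> [s Fs]; exists (fun i j => a *: s i j) => i.
by rewrite Fs scalerDr -scalemxAr -scalemxAl.
Qed.

Lemma nullN X Y (F : forall i, 'M[A]_(X i, Y i)) :
  null F -> null (fun i => - F i).
Proof. by move/(nullZ (-1)); apply: eq_null => i; rewrite scaleN1r. Qed.

Lemma nullB X Y (F G : forall i, 'M[A]_(X i, Y i)) :
  null F -> null G -> null (fun i => F i - G i).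
Proof. by move=> ? /nullN; apply: nullD. Qed.

Lemma null_mull W X Y (f : chain_map W X) (F : forall i, 'M[A]_(X i, Y i)) :
  null F -> null (fun i => f i *m F i).
Proof.
move=> [s Fs]; exists (fun i j => f i *m s i j) => i.
by rewrite Fs mulmxDr !mulmxA cmapP.
Qed.

Lemma null_mulr X Y Z (F : forall i, 'M[A]_(X i, Y i)) (g : chain_map Y Z) :
  null F -> null (fun i => F i *m g i).
Proof.
move=> [s Fs]; exists (fun i j => s i j *m g j) => i.
by rewrite Fs mulmxDl -!mulmxA cmapP.
Qed.

Lemma is_iso_retract X Y (f : chain_map X Y) : is_iso f ->
  exists g : chain_map Y X, null (fun i => f i *m g i - 1%:M)
    /\ null (fun i => g i *m f i - 1%:M).
Proof. by move=> [g [gf fg]]; exists g. Qed.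

Definition contractible X := null (fun i => 1%:M : 'M[A]_(X i)).

Lemma isomorphic_zeroP X : isomorphic X (zero_complex A) <-> contractible X.
Proof.
split=> [[f /is_iso_retract [g [fg _]]]|X0].
  move/nullN: fg; apply: eq_null => i.
  by rewrite (thinmx0 (f i)) mul0mx sub0r opprK.
exists (cmap_zero _ _), (cmap_zero _ _); split.
  by move/nullN: X0; apply: eq_null => i; rewrite /= mul0mx sub0r.
by apply: eq_null (null0 _ _) => i; apply/matrixP => -[].
Qed.

End Null.

(** * Contractibility and Betti numbers over the residue field *)

Section ContractibleResidue.
Variables (A : comNzRingType) (m : set A) (A_local : local_ring m).
Variables (k : fieldType) (pi : {rmorphism A -> k}).
Hypothesis pi_m : forall x, pi x = 0 <-> m x.
Hypothesis pi_surj : forall y, exists x, pi x = y.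
Implicit Types X Y Z : complex A.

Lemma pi_section : exists sigma : k -> A, cancel sigma pi.
Proof. by have [s sK] := boolp.choice pi_surj; exists s. Qed.

Lemma map_mx_section : exists sigma : forall p q, 'M[k]_(p, q) -> 'M[A]_(p, q),
  forall p q (M : 'M[k]_(p, q)), map_mx pi (sigma p q M) = M.
Proof.
have [sigma sigmaK] := pi_section.
exists (fun p q => map_mx sigma) => p q M.
by apply/matrixP => i j; rewrite !mxE sigmaK.
Qed.

(** The null-homotopic chain map [u] built from [s] is the identity modulo [m], hence invertible in
    each degree. Its inverse [v] is again a chain map, so the identity is null-homotopic along with
    [u]. *)
Lemma contractible_residue X (s : forall i j, 'M[A]_(X i, X j)) :
  (forall i, map_mx pi (diff X i (i + 1) *m s (i + 1) i
                + s i (i - 1) *m diff X (i - 1) i) = 1%:M) ->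
  contractible X.
Proof.
move=> s1.
pose u i := diff X i (i + 1) *m s (i + 1) i + s i (i - 1) *m diff X (i - 1) i.
have uP i j : u i *m diff X i j = diff X i j *m u j.
  have [->|ij] := eqVneq j (i + 1); last by rewrite diff_shape // mulmx0 mul0mx.
  rewrite /u mulmxDl mulmxDr !mulmxA diffK mul0mx add0r -!mulmxA diffK mulmx0 addr0.
  by rewrite (_ : i + 1 - 1 = i) ?mulmxA ?addrK.
pose v i := projT1 (cid (invertible_residue A_local pi_m (s1 i))).
have uv i : u i *m v i = 1%:M by rewrite /v; case: cid => ? [].
have vu i : v i *m u i = 1%:M by rewrite /v; case: cid => ? [].
have vP i j : v i *m diff X i j = diff X i j *m v j.
  rewrite -[LHS]mulmx1 -(uv j) mulmxA -(mulmxA (v i)) -uP.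
  by rewrite [v i *m _]mulmxA vu mul1mx.
have : null u by exists s.
by move/null_mulr => /(_ _ (ChainMap vP)); apply: eq_null => i; rewrite /= uv.
Qed.

Definition res_diff X i j := map_mx pi (diff X i j).

Lemma res_diffK X i j l : res_diff X i j *m res_diff X j l = 0.
Proof. by rewrite -map_mxM diffK map_mx0. Qed.

(* The dimension of H^i(X (x) A/m). *)
Definition betti X i :=
  (\rank (kermx (res_diff X i (i + 1))) - \rank (res_diff X (i - 1) i))%N.

Lemma betti_rank_le X i :
  (\rank (res_diff X (i - 1) i) <= \rank (kermx (res_diff X i (i + 1))))%N.
Proof. by apply/mxrankS/sub_kermxP/res_diffK. Qed.

Lemma betti_sum X Y i : betti (sum_complex X Y) i = (betti X i + betti Y i)%N.
Proof.
move: (betti_rank_le Y i) (betti_rank_le X i).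
rewrite /betti !mxrank_ker /res_diff /= /sum_diff.
have rk_sum a b : \rank (map_mx pi (block_mx (diff X a b) 0 0 (diff Y a b))) =
    (\rank (map_mx pi (diff X a b)) + \rank (map_mx pi (diff Y a b)))%N.
  by rewrite map_block_mx !map_mx0 rank_diag_block_mx.
rewrite !rk_sum.
have arith (x y a b c d : nat) : (b <= y -> a <= x -> d <= y - b -> c <= x - a ->
  x + y - (a + b) - (c + d) = x - a - c + (y - b - d))%N by lia.
by apply: arith; exact: rank_leq_row.
Qed.

Lemma contractible_betti X : (forall i, betti X i = 0%N) -> contractible X.
Proof.
move=> X0; have [sigma sigmaK] := map_mx_section.
pose d i := res_diff X i (i + 1).
(* A contraction over the residue field: the projection onto the cocycles, followed by a choice of
   primitives. Any lift of it will do, since only its reduction matters. *)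
pose s i j := (1%:M - d i *m pinvmx (d i)) *m pinvmx (res_diff X j i).
apply: (@contractible_residue X (fun i j => sigma _ _ (s i j))) => i.
rewrite map_mxD !map_mxM !sigmaK.
transitivity (d i *m pinvmx (d i) + (1%:M - d i *m pinvmx (d i)));
  last by rewrite subrKC.
congr (_ + _); rewrite /s.
  rewrite mulmxA mulmxBr mulmx1 [_ *m (d _ *m _)]mulmxA.
  by rewrite [map_mx _ _ *m _]res_diffK mul0mx subr0.
rewrite mulmxKpV //.
apply: submx_trans (_ : (kermx (d i) <= _)%MS).
  by apply/sub_kermxP; rewrite mulmxBl mul1mx mulmxKpV // subrr.
have sBK : (res_diff X (i - 1) i <= kermx (d i))%MS.
  exact/sub_kermxP/res_diffK.
by rewrite -(geq_leqif (mxrank_leqif_sup sBK)) -subn_eq0 -/(betti X i) X0.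
Qed.

(** On cohomology over the residue field [f] is injective, because [g] inverts it on one side: this
    is [gC]. The rest counts dimensions. *)
Lemma betti_retract X Y (f : chain_map X Y) (g : chain_map Y X) i :
  null (fun i => f i *m g i - 1%:M) -> (betti X i <= betti Y i)%N.
Proof.
move=> [s fg].
pose fi := map_mx pi (f i); pose gi := map_mx pi (g i).
set KX := kermx (res_diff X i (i + 1)); set KY := kermx (res_diff Y i (i + 1)).
set BX := res_diff X (i - 1) i; set BY := res_diff Y (i - 1) i.
have sBK : (BY <= KY)%MS by apply/sub_kermxP/res_diffK.
have fK : (KX *m fi <= KY)%MS.
  apply/sub_kermxP; rewrite -mulmxA -map_mxM cmapP map_mxM mulmxA.
  by rewrite mulmx_ker mul0mx.
have gB : (BY *m gi <= BX)%MS.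
  by rewrite /BY /gi /res_diff -map_mxM -cmapP map_mxM submxMl.
have gC : (KX :&: kermx (fi *m cokermx BY) <= BX)%MS.
  apply/rV_subP => v; rewrite sub_capmx => /andP[/sub_kermxP vK /sub_kermxP].
  rewrite mulmxA => vB.
  have vfB : (v *m fi <= BY)%MS by rewrite submxE vB.
  have -> : v = v *m fi *m gi
      - v *m map_mx pi (s i (i - 1)) *m BX.
    have := congr1 (fun M => v *m map_mx pi M) (fg i).
    rewrite map_mxB map_mxD !map_mxM mulmxDr !mulmxA vK mul0mx add0r map_mx1.
    rewrite mulmxBr mulmx1 mulmxA -/fi -/gi => /eqP.
    by rewrite subr_eq addrC => /eqP ->; rewrite addrK.
  by rewrite addmx_sub ?eqmx_opp ?submxMl // (submx_trans (submxMr _ vfB)).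
rewrite /betti -/KX -/KY -/BX -/BY.
have := mxrank_mul_ker KX (fi *m cokermx BY).
have := mxrank_mul_ker KY (cokermx BY).
have := mxrankS gC.
have : (\rank (KX *m (fi *m cokermx BY)) <= \rank (KY *m cokermx BY))%N.
  by rewrite mulmxA mxrankS // submxMr.
have : (\rank BY <= \rank (KY :&: kermx (cokermx BY))%MS)%N.
  by rewrite mxrankS // sub_capmx sBK; apply/sub_kermxP/mulmx_coker.
lia.
Qed.

End ContractibleResidue.

(** * Inclusions and projections of a direct sum *)

Section Sums.
Variable A : comNzRingType.
Variables X Y : complex A.

Fact sum_inl_subproof i j :
  (row_mx 1%:M 0 : 'M_(X i, X i + Y i)) *m diff (sum_complex X Y) i j =
  diff X i j *m row_mx 1%:M 0.
Proof.
by rewrite /= /sum_diff mul_row_block mul_mx_row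
           !(mulmx0, mul0mx, mulmx1, mul1mx, addr0, add0r).
Qed.
Definition sum_inl : chain_map X (sum_complex X Y) :=
  @ChainMap _ X (sum_complex X Y) (fun i => row_mx 1%:M 0) sum_inl_subproof.

Fact sum_inr_subproof i j :
  (row_mx 0 1%:M : 'M_(Y i, X i + Y i)) *m diff (sum_complex X Y) i j =
  diff Y i j *m row_mx 0 1%:M.
Proof.
by rewrite /= /sum_diff mul_row_block mul_mx_row
           !(mulmx0, mul0mx, mulmx1, mul1mx, addr0, add0r).
Qed.
Definition sum_inr : chain_map Y (sum_complex X Y) :=
  @ChainMap _ Y (sum_complex X Y) (fun i => row_mx 0 1%:M) sum_inr_subproof.

Fact sum_fst_subproof i j :
  (col_mx 1%:M 0 : 'M_(X i + Y i, X i)) *m diff X i j =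
  diff (sum_complex X Y) i j *m col_mx 1%:M 0.
Proof.
by rewrite /= /sum_diff mul_block_col mul_col_mx
           !(mulmx0, mul0mx, mulmx1, mul1mx, addr0, add0r).
Qed.
Definition sum_fst : chain_map (sum_complex X Y) X :=
  @ChainMap _ (sum_complex X Y) X (fun i => col_mx 1%:M 0) sum_fst_subproof.

Fact sum_snd_subproof i j :
  (col_mx 0 1%:M : 'M_(X i + Y i, Y i)) *m diff Y i j =
  diff (sum_complex X Y) i j *m col_mx 0 1%:M.
Proof.
by rewrite /= /sum_diff mul_block_col mul_col_mx
           !(mulmx0, mul0mx, mulmx1, mul1mx, addr0, add0r).
Qed.
Definition sum_snd : chain_map (sum_complex X Y) Y :=
  @ChainMap _ (sum_complex X Y) Y (fun i => col_mx 0 1%:M) sum_snd_subproof.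

Lemma sum_fst_inl_snd_inr i :
  sum_fst i *m sum_inl i + sum_snd i *m sum_inr i = 1%:M.
Proof.
rewrite /= !mul_col_row !(mulmx0, mul0mx, mulmx1).
by rewrite add_block_mx !(addr0, add0r) -scalar_mx_block.
Qed.

End Sums.

(** * Induction over a decomposition into indecomposables *)

Section Decomposition.
Variables (A : comNzRingType) (m : set A) (A_local : local_ring m).
Variables (k : fieldType) (pi : {rmorphism A -> k}).
Hypothesis pi_m : forall x, pi x = 0 <-> m x.
Hypothesis pi_surj : forall y, exists x, pi x = y.
Implicit Types X Y Z D : complex A.

(** This stands in for a decomposition of [Y]: up to homotopy, the identity is a sum of
    endomorphisms that factor through indecomposables. Splitting stops because the total Betti
    number drops. *)
Lemma decomposition_ind Y (P : (forall i, 'M[A]_(Y i)) -> Prop) :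
  (forall F G : forall i, 'M[A]_(Y i), null (fun i => F i - G i) -> P G -> P F) ->
  P (fun i => 0) -> (forall F G, P F -> P G -> P (fun i => F i + G i)) ->
  (forall D (p : chain_map Y D) (q : chain_map D Y),
     indecomposable D -> P (fun i => p i *m q i)) ->
  P (fun i => 1%:M).
Proof.
move=> P_homotopic P0 PD P_indec.
have [b Yb] := bounded Y.
(* Generalized to endomorphisms through any [D], by induction on a bound for its total Betti number.
   The degrees from -b to b are enumerated as [l - b]. *)
suff main n D (p : chain_map Y D) (q : chain_map D Y) :
    (forall i : int, (b < `|i|)%N -> betti pi D i = 0%N) ->
    (\sum_(l < (b + b).+1) betti pi D (l%:Z - b%:Z) < n)%N ->
    P (fun i => p i *m q i).
  apply: P_homotopic (main _ Y (cmap_id Y) (cmap_id Y) _ (ltnSn _)).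
    by apply: eq_null (null0 Y Y) => i; rewrite /= mulmx1 subrr.
  move=> i /Yb Yi; apply/eqP; rewrite -leqn0 -[X in (_ <= X)%N]Yi.
  exact: leq_trans (leq_subr _ _) (rank_leq_row _).
elim: n D p q => // n IHn D p q Db Dn.
have [/P_indec//|D_dec] := EM (indecomposable D).
have [D0|D_n0] := EM (contractible D).
  apply: P_homotopic P0; apply: eq_null (null_mulr q (null_mull p D0)) => i /=.
  by rewrite mulmx1 subr0.
have [[Y1 [Y2 [[f /is_iso_retract [g [fg gf]]] [Y1n0 Y2n0]]]]|no_dec] :=
  EM (exists Y1 Y2, isomorphic D (sum_complex Y1 Y2) /\
     ~ contractible Y1 /\ ~ contractible Y2); last first.
  case: D_dec; split; first by move/isomorphic_zeroP.
  move=> Y1 Y2 iso; apply: contrapT => /not_orP[Y1n0 Y2n0].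
  by case: no_dec; exists Y1, Y2; split=> //; split=> /isomorphic_zeroP.
have le_betti i : (betti pi Y1 i + betti pi Y2 i <= betti pi D i)%N.
  by rewrite -betti_sum; exact: betti_retract gf.
have betti_gt0 Z : ~ contractible Z -> exists i, (0 < betti pi Z i)%N.
  move=> Zn0; apply: contrapT => Z0; apply: Zn0.
  apply: (contractible_betti A_local pi_m pi_surj) => i.
  by case: (posnP (betti pi Z i)) => // Zi; case: Z0; exists i.
(* The total for [Z] is strictly smaller, since [Z'] takes a positive share in some degree [i0]. *)
have smaller Z Z' : ~ contractible Z' ->
    (forall i, betti pi Z i + betti pi Z' i <= betti pi D i)%N ->
    (forall i : int, (b < `|i|)%N -> betti pi Z i = 0%N) /\
    (\sum_(l < (b + b).+1) betti pi Z (l%:Z - b%:Z) < n)%N.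
  move=> /betti_gt0[i0 Z'i0] ZD; split.
    move=> i /Db Di; have := ZD i; rewrite Di; case: (betti pi Z i) => //.
  have i0b : (`|i0| <= b)%N.
    by rewrite leqNgt; apply/negP => /Db Di; have := ZD i0; rewrite Di; lia.
  have l0P : (absz (i0 + b%:Z)%R < (b + b).+1)%N by lia.
  rewrite -ltnS; apply: leq_ltn_trans Dn.
  rewrite (bigD1 (Ordinal l0P)) //= [X in (_ < X)%N](bigD1 (Ordinal l0P)) //=.
  rewrite -addSn; apply: leq_add; last first.
    by apply: leq_sum => l _; apply: leq_trans (ZD _); exact: leq_addr.
  have -> : Posz (absz (i0 + b%:Z)%R) - b%:Z = i0 by lia.
  by apply: leq_trans (ZD i0); rewrite -addn1 leq_add2l.
have [Y1b Y1n] := smaller Y1 Y2 Y2n0 le_betti.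
have [|Y2b Y2n] := smaller Y2 Y1 Y1n0; first by move=> i; rewrite addnC.
have P1 := IHn Y1 (cmap_comp (sum_fst Y1 Y2) (cmap_comp f p))
  (cmap_comp q (cmap_comp g (sum_inl Y1 Y2))) Y1b Y1n.
have P2 := IHn Y2 (cmap_comp (sum_snd Y1 Y2) (cmap_comp f p))
  (cmap_comp q (cmap_comp g (sum_inr Y1 Y2))) Y2b Y2n.
(* By the biproduct identity, [p] followed by [q] differs from the sum of its parts through [Y1] and
   [Y2] only by the null-homotopic defect of [f] and [g]. *)
have aux a1 a2 a3 a4 a5 (M : 'M[A]_(a1, a2)) (F : 'M_(a2, a3)) (G : 'M_(a3, a2))
    (N : 'M_(a2, a1)) (S : 'M_(a3, a4)) (I : 'M_(a4, a3)) (S' : 'M_(a3, a5))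
    (I' : 'M_(a5, a3)) : S *m I + S' *m I' = 1%:M ->
    M *m N - (M *m F *m S *m (I *m G *m N) + M *m F *m S' *m (I' *m G *m N)) =
    - (M *m (F *m G - 1%:M) *m N).
  move=> SI; rewrite mulmxBr mulmxBl mulmx1 opprB; congr (_ - _).
  by rewrite -!mulmxA -!mulmxDr !(mulmxA _ _ (G *m N)) -mulmxDl SI mul1mx !mulmxA.
apply: P_homotopic (PD _ _ P1 P2).
have := nullN (null_mulr q (null_mull p fg)).
apply: eq_null => i; apply: esym.
exact: aux (sum_fst_inl_snd_inr Y1 Y2 i).
Qed.

End Decomposition.

(** * Identification of equal degrees *)

Section Transport.
Variable A : comNzRingType.
Implicit Types X Y : complex A.

Lemma transport_map X Y (F : forall i, 'M[A]_(X i, Y i)) i j :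
  F i *m transport Y i j = transport X i j *m F j.
Proof.
have [->|ij] := eqVneq i j; first by rewrite !transport_id mulmx1 mul1mx.
by rewrite !transport_neq // mulmx0 mul0mx.
Qed.

Lemma transport_diffl X i j l : i = j ->
  transport X i j *m diff X j l = diff X i l.
Proof. by move=> ->; rewrite transport_id mul1mx. Qed.

Lemma transport_diffr X i j l : j = l ->
  diff X i j *m transport X j l = diff X i l.
Proof. by move=> ->; rewrite transport_id mulmx1. Qed.

Lemma transport_comp X i j l : i = j ->
  transport X i j *m transport X j l = transport X i l.
Proof. by move=> ->; rewrite transport_id mul1mx. Qed.

End Transport.

(** * The homotopy fiber and its factorization property *)

Section Fiber.
Variable A : comNzRingType.
Variables (X Z : complex A) (f : chain_map X Z).

(** Up to signs, the differential of the mapping cone of [f] shifted by -1. The factor [transport]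
    vanishes unless j = i + 1. *)
Definition fiber_diff i j : 'M[A]_(X i + Z (i - 1), X j + Z (j - 1)) :=
  block_mx (diff X i j) (f i *m transport Z i (j - 1)) 0 (- diff Z (i - 1) (j - 1)).

Fact fiber_diff_shape i j : j != i + 1 -> fiber_diff i j = 0.
Proof.
move=> ij; rewrite /fiber_diff !diff_shape // ?transport_neq; try lia.
by rewrite oppr0 mulmx0 block_mx0.
Qed.

Fact fiber_diffK i j l : fiber_diff i j *m fiber_diff j l = 0.
Proof.
have [jE|ij] := eqVneq j (i + 1); last by rewrite fiber_diff_shape // mul0mx.
have [lE|jl] := eqVneq l (j + 1);
  last by rewrite [fiber_diff _ l]fiber_diff_shape // mulmx0.
rewrite mulmx_block !(mulmx0, mul0mx, addr0, add0r) mulNmx !mulmxN opprK !diffK.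
rewrite -(mulmxA (f i)) transport_diffl; last by lia.
rewrite mulmxA -cmapP -mulmxA transport_diffr; last by lia.
by rewrite subrr block_mx0.
Qed.

Fact fiber_bounded :
  exists b : nat, forall i : int, (b < `|i|)%N -> (X i + Z (i - 1)%R = 0)%N.
Proof.
have [[b Xb] [c Zc]] := (bounded X, shift_bounded (- 1) Z).
by exists (maxn b c) => i; rewrite gtn_max => /andP[/Xb-> /Zc->].
Qed.

Definition fiber : complex A :=
  Complex fiber_diff_shape fiber_diffK fiber_bounded.

Fact fiber_proj_subproof i j :
  (col_mx 1%:M 0 : 'M_(X i + Z (i - 1), X i)) *m diff X i j =
  diff fiber i j *m col_mx 1%:M 0.
Proof.
by rewrite /= /fiber_diff mul_block_col mul_col_mx
           !(mulmx0, mul0mx, mulmx1, mul1mx, addr0, add0r).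
Qed.
Definition fiber_proj : chain_map fiber X :=
  @ChainMap _ fiber X (fun i => col_mx 1%:M 0) fiber_proj_subproof.

Lemma fiber_proj_null : null (fun i => fiber_proj i *m f i).
Proof.
(* The homotopy is the projection of the fiber to its summand Z[-1]. *)
exists (fun i j => col_mx 0 (transport Z (i - 1) j)) => i /=.
rewrite /fiber_diff mul_block_col !mul_col_mx !(mulmx0, mul0mx, mul1mx, add0r).
rewrite -(mulmxA (f i)) transport_comp ?transport_id ?mulmx1; last by lia.
by rewrite mulNmx transport_diffr ?mul1mx ?add_col_mx ?addr0 ?addNr; last by lia.
Qed.

(** A null-homotopy on the fiber has two components: [l], on the summand Z[-1], is the factor
    sought, and [u], on X, is the homotopy between [h] and the composite. *)
Lemma fiber_factor W (h : chain_map X W) :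
  null (fun i => fiber_proj i *m h i) ->
  exists h' : chain_map Z W, null (fun i => h i - f i *m h' i).
Proof.
move=> [s hs].
pose u i j : 'M_(X i, W j) := usubmx (s i j).
pose l i j : 'M_(Z (i - 1), W j) := dsubmx (s i j).
have {}hs i : h i = diff X i (i + 1) *m u (i + 1) i
      + f i *m transport Z i (i + 1 - 1) *m l (i + 1) i
      + u i (i - 1) *m diff W (i - 1) i /\
    l i (i - 1) *m diff W (i - 1) i = diff Z (i - 1) (i + 1 - 1) *m l (i + 1) i.
  have := hs i; rewrite /= /fiber_diff mul_col_mx mul1mx mul0mx.
  rewrite -[s (i + 1) i]vsubmxK -[s i (i - 1)]vsubmxK mul_block_col mul_col_mx.
  rewrite mul0mx add0r add_col_mx => /eq_col_mx[h1 h2]; split=> //.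
  by apply/eqP; rewrite -subr_eq0 -mulNmx [X in X == _]addrC; apply/eqP/esym.
pose h' i := transport Z i (i + 1 - 1) *m l (i + 1) i.
have h'P i j : h' i *m diff W i j = diff Z i j *m h' j.
  have [->|ij] := eqVneq j (i + 1); last by rewrite !diff_shape // mulmx0 mul0mx.
  have lP a b : a = b ->
      l (i + 1) a *m diff W a (i + 1) = l (i + 1) b *m diff W b (i + 1).
    by move=> ->.
  rewrite /h' -mulmxA (lP i (i + 1 - 1)) ?(hs (i + 1)).2 ?addrK // !mulmxA.
  rewrite transport_diffl ?transport_diffr //; lia.
exists (ChainMap h'P), u => i.
by rewrite (hs i).1 /= /h' mulmxA addrAC addrK.
Qed.

End Fiber.

(** * Factorization of maps that die in a mapping cone *)

Section ConeFactor.
Variable A : comNzRingType.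
Variables (X Z : complex A) (f : chain_map X Z).

Lemma cone_inj_null : null (fun i => f i *m cone_inj f i).
Proof.
exists (fun i j => row_mx (transport X i (j + 1)) 0) => i /=.
rewrite /cone_diff !mul_mx_row mul_row_block !(mulmx0, mul0mx, mulmx1, addr0).
rewrite transport_id mulmx1 mulmxN transport_diffl; last by lia.
rewrite mulmxA -transport_map -mulmxA transport_comp ?transport_id ?mulmx1; last by lia.
by rewrite add_row_mx subrr add0r.
Qed.

(** Dual to [fiber_factor]: the component [l] of the null-homotopy with values in X[1] is the
    factor, and the component [u] with values in Z is the homotopy. *)
Lemma cone_factor V (v : chain_map V Z) :
  null (fun i => v i *m cone_inj f i) ->
  exists r : chain_map V X, null (fun i => v i - r i *m f i).
Proof.
move=> [s vs].
pose l i j : 'M_(V i, X (j + 1)) := lsubmx (s i j).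
pose u i j : 'M_(V i, Z j) := rsubmx (s i j).
have {}vs i : v i = diff V i (i + 1) *m u (i + 1) i
      + (l i (i - 1) *m (f (i - 1 + 1) *m transport Z (i - 1 + 1) i)
      + u i (i - 1) *m diff Z (i - 1) i) /\
    l i (i - 1) *m diff X (i - 1 + 1) (i + 1) = diff V i (i + 1) *m l (i + 1) i.
  have := vs i; rewrite /= /cone_diff mul_mx_row mulmx1 mulmx0.
  rewrite -[s (i + 1) i]hsubmxK -[s i (i - 1)]hsubmxK mul_row_block mul_mx_row.
  rewrite mulmx0 addr0 add_row_mx => /eq_row_mx[h1 h2]; split=> //.
  by apply/esym/eqP; rewrite -subr_eq0 -mulmxN; apply/eqP/esym.
pose r i := l i (i - 1) *m transport X (i - 1 + 1) i.
have rP i j : r i *m diff X i j = diff V i j *m r j.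
  have [->|ij] := eqVneq j (i + 1); last by rewrite !diff_shape // mulmx0 mul0mx.
  have lP a : a = i -> l (i + 1) a *m transport X (a + 1) (i + 1) = l (i + 1) i.
    by move=> ->; rewrite transport_id mulmx1.
  rewrite /r lP -?(vs i).2 -?mulmxA ?transport_diffl //; lia.
exists (ChainMap rP), u => i.
rewrite (vs i).1 /= /r -mulmxA -transport_map.
by rewrite [l _ _ *m _ + _]addrC addrA addrK.
Qed.

End ConeFactor.

(** * Passage between endomorphisms of X and of X[-1] *)

Section Shift.
Variable A : comNzRingType.
Variable X : complex A.

Lemma null_shift (F : forall i, 'M[A]_(X i)) : null F ->
  null (fun i => F (i - 1) : 'M[A]_(shift (-1) X i, shift (-1) X i)).
Proof.
move=> [s Fs]; exists (fun i j => - s (i - 1) (j - 1)) => i.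
rewrite /= /shift_diff expr1 !scaleN1r !mulNmx !mulmxN !opprK Fs.
by rewrite (addrAC i).
Qed.

(** An endomorphism of X[-1] read as one of X. The degrees [i + 1 - 1] and [i] are equal but not
    convertible, hence the two transports. *)
Definition unshift_endo (K : forall i, 'M[A]_(shift (-1) X i)) i : 'M[A]_(X i) :=
  transport X i (i + 1 - 1) *m (K (i + 1) : 'M_(X (i + 1 - 1)))
  *m transport X (i + 1 - 1) i.

Lemma unshift_endoK (K : forall i, 'M[A]_(shift (-1) X i)) i :
  unshift_endo K (i - 1) = K i.
Proof.
suff KE j : j = i ->
    transport X (i - 1) (j - 1) *m (K j : 'M_(X (j - 1)))
    *m transport X (j - 1) (i - 1) = K i by apply: KE; lia.
by move=> ->; rewrite transport_id mul1mx mulmx1.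
Qed.

Lemma unshift_endoP (K : chain_map (shift (-1) X) (shift (-1) X)) i j :
  unshift_endo K i *m diff X i j = diff X i j *m unshift_endo K j.
Proof.
have := cmapP K (i + 1) (j + 1).
rewrite /= /shift_diff expr1 !scaleN1r mulmxN mulNmx => /oppr_inj KP.
rewrite /unshift_endo -!mulmxA transport_diffl; last by lia.
rewrite !(mulmxA (diff X i j)) transport_diffr; last by lia.
rewrite -(@transport_diffl _ X i (i + 1 - 1)) -?mulmxA; last by lia.
rewrite [X in _ = _ *m X]mulmxA -KP -!mulmxA transport_diffr //; lia.
Qed.

Lemma unshift_endo_null (K : forall i, 'M[A]_(shift (-1) X i)) :
  null K -> null (unshift_endo K).
Proof.
move=> [s Ks].
exists (fun i j => - (transport X i (i + 1 - 1)
   *m (s (i + 1) (j + 1) : 'M_(X (i + 1 - 1), X (j + 1 - 1)))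
   *m transport X (j + 1 - 1) j)) => i.
rewrite /unshift_endo Ks /= /shift_diff expr1 !scaleN1r !(mulNmx, mulmxN).
rewrite mulmxDr mulmxDl !(mulNmx, mulmxN); congr (- _ - _).
  rewrite !mulmxA transport_diffl; last by lia.
  by rewrite transport_diffr //; lia.
have sP a b : a = b ->
    (s (i + 1) a : 'M_(X (i + 1 - 1), X (a - 1))) *m diff X (a - 1) i =
    (s (i + 1) b : 'M_(X (i + 1 - 1), X (b - 1))) *m diff X (b - 1) i.
  by move=> ->.
rewrite -!mulmxA transport_diffr; last by lia.
rewrite transport_diffl; last by lia.
by congr (_ *m _); apply: sP; lia.
Qed.

End Shift.

(** * Submodules, spans and the ascending chain condition *)

Section Span.
Variables (A : comNzRingType) (V : lmodType A).
Implicit Types (P : set V).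

Lemma submoduleD P u v : submodule P -> P u -> P v -> P (u + v).
Proof. by move=> [_ PP] Pu Pv; rewrite -[u]scale1r; exact: PP. Qed.

Lemma submoduleZ P a u : submodule P -> P u -> P (a *: u).
Proof. by move=> [P0 PP] Pu; rewrite -[_ *: _]addr0; exact: PP. Qed.

Lemma submoduleB P u v : submodule P -> P u -> P v -> P (u - v).
Proof.
by move=> Psub Pu Pv; rewrite -scaleN1r; apply: submoduleD => //; exact: submoduleZ.
Qed.

Lemma submodule_sum P (I : Type) (r : seq I) (F : I -> V) :
  submodule P -> (forall i, P (F i)) -> P (\sum_(i <- r) F i).
Proof.
move=> Psub PF; apply: big_ind => //; first by case: Psub.
by move=> u v; exact: submoduleD.
Qed.

Definition span (G : set V) : set V :=
  [set x | forall P, submodule P -> G `<=` P -> P x].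

Lemma span_submodule G : submodule (span G).
Proof.
split; first by move=> P [].
by move=> a u v Gu Gv P Psub GP; apply: Psub.2; [exact: Gu|exact: Gv].
Qed.

Lemma sub_span G : G `<=` span G.
Proof. by move=> x Gx P _; exact. Qed.

Lemma span_sub G P : submodule P -> G `<=` P -> span G `<=` P.
Proof. by move=> Psub GP x; exact. Qed.

Lemma spanS G H : G `<=` H -> span G `<=` span H.
Proof.
move=> GH; apply: span_sub; first exact: span_submodule.
by move=> x /GH; exact: sub_span.
Qed.

(** The ascending chain condition, put in terms of vectors: this form serves both Krull's theorem
    and the termination of a composition series. *)
Definition noetherian_seq : Prop :=
  forall v : nat -> V, exists N, span [set v j | j in [set j | (j < N)%N]] (v N).

End Span.

(** * Noetherian modules over a Noetherian ring *)

Section Noetherian.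
Variables (A : comNzRingType) (A_noetherian : noetherian A).

Lemma noetherian_gens (I : set A) : ideal I ->
  exists s : seq A, (forall i, (i < size s)%N -> I s`_i) /\
    forall x, I x -> exists c : nat -> A, x = \sum_(i < size s) c i * s`_i.
Proof.
move=> /A_noetherian[s sP]; exists s; split=> [i si|x /sP //]; apply/sP.
exists (fun j => (j == i)%:R); rewrite (bigD1 (Ordinal si)) //= eqxx mul1r.
rewrite big1 ?addr0 // => j; rewrite -val_eqE /= => /negPf ->.
by rewrite mul0r.
Qed.

(** Linear forms take the place of coordinates. By induction on [s], the values of a new form [t] on
    the vectors of [P] killed by the earlier forms make an ideal, and finitely many vectors lift its
    generators. *)
Lemma noetherian_forms (V : lmodType A) (T : eqType) (phi : T -> V -> A)
    (s : seq T) (P : set V) :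
  (forall t a u v, phi t (a *: u + v) = a * phi t u + phi t v) ->
  submodule P ->
  exists g : seq V, (forall x, x \in g -> P x) /\
    forall x, P x -> exists y, span [set` g] y /\
      forall t, t \in s -> phi t (x - y) = 0.
Proof.
move=> phiP Psub.
have phi0 t : phi t 0 = 0.
  by have := phiP t (-1) 0 0; rewrite scaler0 addr0 mulN1r addNr.
have phiD t u v : phi t (u + v) = phi t u + phi t v.
  by rewrite -[u]scale1r phiP mul1r scale1r.
have phiZ t a u : phi t (a *: u) = a * phi t u.
  by rewrite -[_ *: _]addr0 phiP phi0 addr0.
elim: s => [|t s [g [gP gspan]]].
  by exists [::]; split=> // x _; exists 0; split=> // Q [].
pose K x := P x /\ forall t', t' \in s -> phi t' x = 0.
have [|l [lI lgen]] := @noetherian_gens [set phi t x | x in K].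
  split; first by exists 0; [split=> //; case: Psub|].
  move=> a _ _ [u [Pu Ku] <-] [v [Pv Kv] <-]; exists (a *: u + v); last exact: phiP.
  split; first by apply: Psub.2.
  by move=> t' t's; rewrite phiP Ku // Kv // mulr0 addr0.
have [y yP] : exists y : nat -> V,
    forall i, (i < size l)%N -> K (y i) /\ phi t (y i) = l`_i.
  suff /boolp.choice[y yP] : forall i, exists y,
      (i < size l)%N -> K y /\ phi t y = l`_i.
    by exists y.
  move=> i; have [il|] := boolP (i < size l)%N; last by exists 0.
  by have [y Ky yE] := lI i il; exists y.
exists (g ++ mkseq y (size l)); split=> [x|x Px].
  rewrite mem_cat => /orP[/gP//|/mapP[i]].
  by rewrite mem_iota add0n => /= /yP[[Py _] _] ->.
have [z [gz xz]] := gspan _ Px.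
have Pz : P z by apply: gz => // u; exact: gP.
have [|c xzE] := lgen (phi t (x - z)).
  by exists (x - z) => //; split=> //; exact: submoduleB.
(* The vectors [y i] are killed by the forms of [s], so this correction changes only the value at
   [t]. *)
exists (z + \sum_(i < size l) c i *: y i); split.
  apply: (submoduleD (span_submodule _)).
    by apply: spanS gz => u /= ug; rewrite mem_cat ug.
  apply: (submodule_sum _ (span_submodule _)) => i.
  apply: (submoduleZ _ (span_submodule _)); apply: sub_span => /=.
  rewrite mem_cat; apply/orP; right; apply: map_f; rewrite mem_iota /=; exact: ltn_ord.
have phi_sum t' n (F : nat -> V) :
    phi t' (\sum_(i < n) F i) = \sum_(i < n) phi t' (F i).
  elim: n => [|n IHn]; first by rewrite !big_ord0.
  by rewrite !big_ord_recr /= phiD IHn.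
have phiB t' u v : phi t' (u - v) = phi t' u - phi t' v.
  by rewrite -scaleN1r phiD phiZ mulN1r.
move=> t'; rewrite inE opprD addrA phiB (phi_sum _ _ (fun i => c i *: y i)).
move=> /orP[/eqP->|t's].
  apply/eqP; rewrite subr_eq0 xzE; apply/eqP/eq_bigr => i _.
  by rewrite phiZ (yP i _).2.
rewrite xz // sub0r big1 ?oppr0 // => i _.
by rewrite phiZ (yP i _).1.2 ?mulr0.
Qed.

(** The union [P] of the increasing spans is finitely generated, as the forms separate points; its
    generators already lie in a single [S N]. *)
Lemma noetherian_seq_forms (V : lmodType A) (T : eqType) (phi : T -> V -> A)
    (s : seq T) :
  (forall t a u v, phi t (a *: u + v) = a * phi t u + phi t v) ->
  (forall x, (forall t, t \in s -> phi t x = 0) -> x = 0) ->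
  noetherian_seq V.
Proof.
move=> phiP phi_inj v.
pose S N := span [set v j | j in [set j | (j < N)%N]].
have SS M N : (M <= N)%N -> S M `<=` S N.
  by move=> MN; apply: spanS => _ [j /= jM <-]; exists j => //=; exact: leq_trans MN.
have Ssub N : submodule (S N) by exact: span_submodule.
pose P x := exists N, S N x.
have Psub : submodule P.
  split; first by exists 0%N; case: (Ssub 0%N).
  move=> a x y [M Mx] [N Ny]; exists (maxn M N); apply: (Ssub _).2.
    by apply: SS Mx; exact: leq_maxl.
  by apply: SS Ny; exact: leq_maxr.
have [g [gP gspan]] := noetherian_forms s phiP Psub.
have [N gN] : exists N, forall x, x \in g -> S N x.
  elim: g gP {gspan} => [|x g IHg] gP; first by exists 0%N.
  have [y yg|M gM] := IHg; first by apply: gP; rewrite inE yg orbT.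
  have [N xN] := gP x (mem_head _ _).
  exists (maxn M N) => y; rewrite inE => /orP[/eqP->|/gM].
    by apply: SS xN; exact: leq_maxr.
  by apply: SS; exact: leq_maxl.
exists N; have [|y [yg /phi_inj/eqP]] := gspan (v N).
  by exists N.+1; apply: sub_span; exists N => /=.
by rewrite subr_eq0 => /eqP ->; exact: (span_sub (Ssub N) gN yg).
Qed.

Lemma noetherian_seq_family (p q : int -> nat) b :
  (forall i : int, (b < `|i|)%N -> (p i * q i = 0)%N) ->
  noetherian_seq (Defs.family (fun i => 'M[A]_(p i, q i))).
Proof.
(* The forms are the matrix entries, indexed by degree and position. There are none in degrees
   outside [-b, b]. *)
move=> pb; pose T := {i : int & ('I_(p i) * 'I_(q i))%type}.
pose phi (t : T) (x : Defs.family (fun i => 'M[A]_(p i, q i))) :=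
  x (tag t) (tagged t).1 (tagged t).2.
pose r := [seq l%:Z - b%:Z | l <- iota 0 (b + b).+1].
pose s : seq T := [seq Tagged (fun i => ('I_(p i) * 'I_(q i))%type) x
   | i <- r, x <- enum {: 'I_(p i) * 'I_(q i)}].
apply: (@noetherian_seq_forms _ _ phi s).
  by move=> [i [a c]] e u v; rewrite /phi /= mxE mxE.
move=> x x0; apply: functional_extensionality_dep => i; apply/matrixP => a c.
rewrite mxE; apply: (x0 (Tagged (fun i => ('I_(p i) * 'I_(q i))%type) (a, c))).
apply/allpairsPdep; exists i, (a, c); split; rewrite ?mem_enum //.
have ib : (`|i| <= b)%N.
  rewrite leqNgt; apply/negP => /pb/eqP; rewrite muln_eq0.
  by case/orP => /eqP pq0; [case: a => j|case: c => j]; rewrite pq0.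
apply/mapP; exists (absz (i + b%:Z)%R); last by lia.
by rewrite mem_iota; lia.
Qed.

End Noetherian.

(** * Krull's intersection argument and finite length *)

Section Krull.
Variables (A : comNzRingType) (m : set A) (A_local : local_ring m).
Variables (A_noetherian : noetherian A).

Lemma local_unit_1B a b : m a -> exists c, (1 - a * b) * c = 1.
Proof.
move=> ma; apply: (local_ring_unit A_local) => m1.
case: A_local => -[mid m1' _] _; apply: m1'.
rewrite -[1](subrK (a * b)); apply: (@submoduleD A A^o _ _ _ mid m1).
rewrite mulrC; exact: (@submoduleZ A A^o _ _ _ mid ma).
Qed.

(* If G N is a combination of the G n for n < N, then F = a^N G N is, up to
   homotopy, a multiple of a F. *)
Lemma krull_null (X Y : complex A) a (F : forall i, 'M[A]_(X i, Y i))
    (G : nat -> forall i, 'M[A]_(X i, Y i)) : m a ->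
  (forall n, null (fun i => F i - a ^+ n *: G n i)) -> null F.
Proof.
move=> ma FG; have [b Xb] := bounded X.
have [|N GN] := @noetherian_seq_family _ A_noetherian X Y b _ (fun n => G n).
  by move=> i /Xb ->; rewrite mul0n.
pose Q (g : Defs.family (fun i => 'M[A]_(X i, Y i))) :=
  exists c, null (fun i => a ^+ N *: g i - (a * c) *: F i).
have [c] : Q (G N).
  apply: GN.
    split.
      exists 0; apply: eq_null (null0 X Y) => i.
      by rewrite scaler0 mulr0 scale0r subrr.
    move=> e u v [c uc] [d vd]; exists (e * c + d).
    have := nullD (nullZ e uc) vd; apply: eq_null => i.
    rewrite [(e *: u + v) i]/(e *: u i + v i) [in RHS]scalerDr [in LHS]scalerBr.
    by rewrite mulrDr scalerDl opprD [in RHS]addrACA !scalerA (mulrC e) (mulrCA e).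
  (* For j < N, the map a^N G_j = a^(N-j) a^j G_j is homotopic to a^(N-j) F, a multiple of a F. *)
  move=> _ [j /= jN <-]; exists (a ^+ (N - j.+1)).
  have := nullZ (a ^+ (N - j)) (FG j) => /nullN; apply: eq_null => i.
  rewrite scalerBr opprB scalerA -exprD subnK ?(ltnW jN) //.
  by rewrite -exprS subnSK.
(* Now F is homotopic to a c F, and 1 - a c is a unit. *)
move=> /(nullD (FG N)) Fc; have [d cd] := local_unit_1B c ma.
have := nullZ d Fc; apply: eq_null => i.
by rewrite addrA subrK -[X in X - _]scale1r -scalerBl scalerA mulrC cd scale1r.
Qed.

(** Starting from 0, vectors that [m] multiplies into the submodule reached so far are adjoined one
    at a time. Each step has a simple quotient, and the chain condition stops the process at the
    whole module. *)
Lemma finite_length_torsion (V : lmodType A) : noetherian_seq V ->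
  (forall a (x : V), m a -> exists n, a ^+ n *: x = 0) -> finite_length V.
Proof.
move=> V_noeth V_torsion.
have m_ideal : ideal m by case: A_local => -[].
(* For each generator [a] of [m] in turn, [x] is replaced by its multiple by the last power of [a]
   that keeps it outside [P]. *)
have socle (P : set V) : submodule P -> P <> setT ->
    exists x, ~ P x /\ forall a, m a -> P (a *: x).
  move=> Psub PT; have [s [sm s_gen]] := noetherian_gens A_noetherian m_ideal.
  have [x0 Px0] : exists x, ~ P x.
    apply: contrapT => /forallNP P'; apply: PT; apply/seteqP.
    by split=> // x _; exact: contrapT.
  suff [x [Px sx]] : exists x, ~ P x /\ forall a, a \in s -> P (a *: x).
    exists x; split=> // a /s_gen[c ->]; rewrite scaler_suml.
    apply: (submodule_sum _ Psub) => i; rewrite -scalerA; apply: (submoduleZ _ Psub).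
    exact/sx/mem_nth.
  have {}sm a : a \in s -> m a by move=> /(nthP 0)[i /sm si <-].
  elim: s sm {s_gen} => [|a s IHs] sm; first by exists x0.
  have [b bs|x [Px sx]] := IHs; first by apply: sm; rewrite inE bs orbT.
  have exP : exists n, `[< P (a ^+ n *: x) >].
    have [n an] := V_torsion a x (sm _ (mem_head _ _)).
    by exists n; apply/asboolP; rewrite an; case: Psub.
  case: (ex_minnP exP) => -[|n] /asboolP Pn min_n.
    by case: Px; move: Pn; rewrite expr0 scale1r.
  exists (a ^+ n *: x); split.
    by move=> /asboolP/min_n; rewrite ltnn.
  move=> b; rewrite inE => /orP[/eqP->|/sx bx]; first by rewrite scalerA -exprS.
  by rewrite scalerA mulrC -scalerA; exact: (submoduleZ _ Psub).
have [P|f fP] := @boolp.choice _ _ (fun (P : set V) x =>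
    submodule P -> P <> setT -> ~ P x /\ forall a, m a -> P (a *: x)).
  have [[Psub PT]|nP] := EM (submodule P /\ P <> setT).
    by have [x xP] := socle P Psub PT; exists x.
  by exists 0 => Psub PT; case: nP.
pose S := fix S n : set V := if n is n'.+1 then
  [set y | exists u c, S n' u /\ y = u + c *: f (S n')] else [set 0].
have Ssub n : submodule (S n).
  elim: n => [|n [S0 SS]] /=.
    by split=> // a u v -> ->; rewrite scaler0 addr0.
  split; first by exists 0, 0; rewrite scale0r addr0.
  move=> a _ _ [u [c [Su ->]]] [v [d [Sv ->]]].
  exists (a *: u + v), (a * c + d); split; first exact: SS.
  by rewrite scalerDr scalerA addrACA scalerDl.
have S_succ n : S n `<=` S n.+1 by move=> u Su; exists u, 0; rewrite scale0r addr0.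
have S_f n : S n.+1 (f (S n)).
  by exists 0, 1; rewrite scale1r add0r; split=> //; case: (Ssub n).
have S_le i n : (i <= n)%N -> S i `<=` S n.
  by elim: n => [|n IHn]; rewrite leq_eqVlt => /orP[/eqP->//|] //= /IHn h u /h/S_succ.
have exT : exists n, `[< S n = setT >].
  apply: contrapT => /forallNP noT.
  have [N fN] := V_noeth (fun n => f (S n)).
  have [|] := fP (S N) (Ssub N); first by move=> /asboolP; exact: noT.
  case; apply: (span_sub (Ssub N) _ fN) => _ [j /= jN <-].
  exact: (S_le j.+1 N jN _ (S_f j)).
case: (ex_minnP exT) => n /asboolP ST min_n.
exists n, S; split=> // i lt_in.
have SiT : S i <> setT by move=> /asboolP/min_n; rewrite leqNgt lt_in.
have [fSi mfSi] := fP _ (Ssub i) SiT.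
split; first by split=> // h; apply: fSi; apply: h; exact: S_f.
move=> P Psub SP PS; have [PSi|nPSi] := EM (P `<=` S i).
  by left; apply/seteqP.
right; apply/seteqP; split=> //.
have [y [Py Sy]] : exists y, P y /\ ~ S i y.
  apply: contrapT => /forallNP h; apply: nPSi => y Py.
  by apply: contrapT => Sy; apply: (h y).
have [u [c [Su yE]]] := PS _ Py.
(* As [y] lies outside [S i], its coefficient [c] is not in [m]; so it is a unit and [P] contains
   the adjoined vector. *)
have [b cb] : exists b, c * b = 1.
  apply: (local_ring_unit A_local) => mc; apply: Sy.
  by rewrite yE; apply: (submoduleD (Ssub i) Su); exact: mfSi.
have Pf : P (f (S i)).
  rewrite -[f _]scale1r -cb mulrC -scalerA; apply: (submoduleZ _ Psub).
  rewrite (_ : c *: _ = y - u); last by rewrite yE addrC addKr.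
  by apply: (submoduleB Psub Py); exact: SP.
move=> _ [v [d [Sv ->]]]; apply: (submoduleD Psub (SP _ Sv)).
exact: (submoduleZ _ Psub Pf).
Qed.

Lemma to_quotZ (V : lmodType A) (S : {pred V}) (S_closed : submod_closed S) a v :
  to_quot S_closed (a *: v) = a *: to_quot S_closed v.
Proof. exact/esym/quotmod_scaleE. Qed.

Lemma total_cohomologyP (X : complex A) (x y : total_cohomology X) :
  (forall i, val x i = val y i) -> x = y.
Proof. by move=> xy; apply/val_inj/functional_extensionality_dep. Qed.

Lemma noetherian_seq_cohomology (X : complex A) :
  noetherian_seq (total_cohomology X).
Proof.
have [b Xb] := bounded X => v.
pose rep (x : total_cohomology X) : Defs.family (fun i => 'M[A]_(1, X i)) :=
  fun i => val (of_quot (val x i)).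
have [|N vN] := @noetherian_seq_family _ A_noetherian (fun=> 1%N) X b _
  (fun n => rep (v n)).
  by move=> i /Xb ->.
exists N => P Psub vP.
(* Relations are found among cocycle representatives; [Q] singles out the families of cocycles whose
   classes form an element of [P]. *)
pose Q (g : Defs.family (fun i => 'M[A]_(1, X i))) :=
  exists x : total_cohomology X, P x /\ forall i, exists w : cocycles X i,
    val w = g i /\ val x i = to_quot (coboundary_closed X i) w.
have [||x [Px xvN]] := vN Q.
- split.
    exists 0; split=> [|i]; first by case: Psub.
    exists 0; split=> //; apply/esym.
    exact: (raddf0 (\pi_(Quotient.quot (quot_pred (coboundary_closed X i))))%qT).
  move=> a g h [x [Px xg]] [y [Py yh]]; exists (a *: x + y).
  split; first exact: Psub.2.
  move=> i; have [[w [wg xw]] [z [zh yz]]] := (xg i, yh i); exists (a *: w + z).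
  split; first by rewrite [LHS]/(a *: val w + val z) wg zh.
  by rewrite to_quotD to_quotZ -xw -yz.
- move=> _ [j /= jN <-]; exists (v j); split; first by apply: vP; exists j.
  by move=> i; exists (of_quot (val (v j) i)); rewrite of_quotK.
rewrite (_ : v N = x) //; apply: total_cohomologyP => i.
by have [w [/val_inj -> ->]] := xvN i; rewrite of_quotK.
Qed.

(** On a cocycle v the homotopy formula leaves a^n v = (v s) d, a coboundary, so the cohomology is
    torsion for each element of [m]. *)
Lemma finite_length_cohomology (X : complex A) :
  (forall a, m a -> exists n, null (fun i => (a ^+ n)%:M : 'M[A]_(X i))) ->
  finite_length (total_cohomology X).
Proof.
move=> X_torsion; apply: finite_length_torsion => [|a x ma].
  exact: noetherian_seq_cohomology.
have [n [s sP]] := X_torsion a ma; exists n.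
apply: total_cohomologyP => i.
rewrite [LHS]/(a ^+ n *: val x i) [RHS]/(0 : cohomology X i).
rewrite -[val x i]of_quotK; apply: (etrans (esym (to_quotZ _ _ _))).
rewrite -[RHS](raddf0 (\pi_(Quotient.quot (quot_pred (coboundary_closed X i))))%qT).
apply/to_quot_eq; rewrite subr0; apply/asboolP.
set w := of_quot _; exists (val w *m s i (i - 1)).
apply: (etrans (esym (mul_mx_scalar _ _))); rewrite sP mulmxDr !mulmxA.
by have /eqP -> := valP w; rewrite mul0mx add0r.
Qed.

End Krull.

(** * Polynomials in a square matrix *)

Section MatrixEvaluation.
Variable R : comNzRingType.
Implicit Types p q : {poly R}.

(* [horner_mx], extended to the square matrices of size 0. *)
Definition mx_eval n : 'M[R]_n -> {poly R} -> 'M[R]_n :=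
  match n with 0%N => fun _ _ => 0 | n'.+1 => fun M p => horner_mx M p end.

Lemma mx_evalD n (M : 'M[R]_n) p q : mx_eval M (p + q) = mx_eval M p + mx_eval M q.
Proof. by case: n M => [|n] M; rewrite /= ?addr0 ?rmorphD. Qed.

Lemma mx_evalM n (M : 'M[R]_n) p q : mx_eval M (p * q) = mx_eval M p *m mx_eval M q.
Proof. by case: n M => [|n] M; rewrite /= ?mul0mx ?rmorphM. Qed.

Lemma mx_evalC n (M : 'M[R]_n) c : mx_eval M c%:P = c%:M.
Proof. by case: n M => [|n] M /=; [apply/matrixP => -[]|exact: horner_mx_C]. Qed.

Lemma mx_evalX n (M : 'M[R]_n) : mx_eval M 'X = M.
Proof. by case: n M => [|n] M /=; [apply/matrixP => -[]|exact: horner_mx_X]. Qed.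

Lemma mx_eval_char_poly n (M : 'M[R]_n) : mx_eval M (char_poly M) = 0.
Proof. by case: n M => [|n] M //=; exact: Cayley_Hamilton. Qed.

(** With a differential as [B], this makes a polynomial in an endomorphism of a complex a chain
    map. *)
Lemma mx_eval_intertwine n1 n2 (M : 'M[R]_n1) (N : 'M[R]_n2) (B : 'M[R]_(n1, n2)) p :
  M *m B = B *m N -> mx_eval M p *m B = B *m mx_eval N p.
Proof.
move=> MB; elim/poly_ind: p => [|p c IHp].
  by rewrite !mx_evalC scalar_mxC.
by rewrite !mx_evalD !mx_evalM !mx_evalC !mx_evalX mulmxDl mulmxDr scalar_mxC
           -mulmxA MB mulmxA IHp mulmxA.
Qed.

End MatrixEvaluation.

Lemma map_mx_eval (R S : comNzRingType) (phi : {rmorphism R -> S}) n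
    (M : 'M[R]_n) (p : {poly R}) :
  map_mx phi (mx_eval M p) = mx_eval (map_mx phi M) (map_poly phi p).
Proof.
case: n M => [|n] M /=; first by rewrite map_mx0.
exact: map_horner_mx.
Qed.

(** The Chinese remainder theorem: as PQ vanishes at [M], [E] and its complement are the projectors
    onto the kernels of Q(M) and P(M). *)
Lemma bezout_idempotent (R : comNzRingType) n (M N : 'M[R]_n) (P Q U V : {poly R}) :
  mx_eval M (P * Q) = 0 ->
  N *m mx_eval M (U * P + V * Q) = 1%:M -> mx_eval M (U * P + V * Q) *m N = 1%:M ->
  let E := N *m mx_eval M (U * P) in
  [/\ E *m E = E, mx_eval M P *m E = mx_eval M P &
      mx_eval M Q *m (1%:M - E) = mx_eval M Q].
Proof.
move=> PQ0 NR RN E; set W := U * P + V * Q in NR RN.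
have comm (S T : {poly R}) : mx_eval M S *m mx_eval M T = mx_eval M T *m mx_eval M S.
  by rewrite -!mx_evalM mulrC.
have commN S : mx_eval M S *m N = N *m mx_eval M S.
  by rewrite -[LHS]mul1mx -NR -!mulmxA (mulmxA (mx_eval M W)) comm -mulmxA RN mulmx1.
have E1 : 1%:M - E = N *m mx_eval M (V * Q).
  by rewrite -NR -mulmxBr /W mx_evalD addrAC subrr add0r.
have QE : mx_eval M Q *m E = 0.
  by rewrite mulmxA commN -mulmxA -mx_evalM mulrCA [Q * P]mulrC mx_evalM PQ0 !mulmx0.
have PE : mx_eval M P *m (1%:M - E) = 0.
  by rewrite E1 mulmxA commN -mulmxA -mx_evalM mulrCA mx_evalM PQ0 !mulmx0.
split; last by rewrite mulmxBr mulmx1 QE subr0.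
  apply/eqP; rewrite -subr_eq0 -oppr_eq0 opprB -{1}[E]mulmx1 -mulmxBr.
  by rewrite {1}/E mx_evalM -!mulmxA PE !mulmx0.
by apply/esym/eqP; rewrite -subr_eq0 -{1}[mx_eval M P]mulmx1 -mulmxBr PE.
Qed.

(** * Splitting of idempotents *)

Section Idempotents.
Variables (A : comNzRingType) (m : set A) (A_local : local_ring m).
Variables (k : fieldType) (pi : {rmorphism A -> k}).
Hypothesis pi_m : forall x, pi x = 0 <-> m x.
Hypothesis pi_surj : forall y, exists x, pi x = y.
Implicit Types X Y Z : complex A.

(** A rank factorization of [E] modulo [m] is lifted, cut down by [E] on both sides, and corrected
    by the inverse [N] of [U *m V]. *)
Lemma idempotent_mx_split n (E : 'M[A]_n) : E *m E = E ->
  exists r (V : 'M[A]_(n, r)) (U : 'M[A]_(r, n)), V *m U = E /\ U *m V = 1%:M.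
Proof.
move=> EE; have [sigma sigmaK] := map_mx_section pi_surj.
pose e := map_mx pi E.
have ee : e *m e = e by rewrite -map_mxM EE.
have [r [C [R [L [L' [CR LC RL']]]]]] : exists r (C : 'M_(n, r)) (R : 'M_(r, n)) L L',
    [/\ C *m R = e, L *m C = 1%:M & R *m L' = 1%:M].
  have /row_fullP[L LC] := col_base_full e.
  have /row_freeP[L' RL'] := row_base_free e.
  by exists (\rank e), (col_base e), (row_base e), L, L'; rewrite mulmx_base.
have RC : R *m C = 1%:M.
  have := congr1 (fun M => L *m M *m L') ee.
  by rewrite -CR -!mulmxA RL' mulmx1 !mulmxA LC mul1mx.
pose V := E *m sigma _ _ C; pose U := sigma _ _ R *m E.
have UV1 : map_mx pi (U *m V) = 1%:M.
  rewrite !map_mxM !sigmaK -/e -CR -!mulmxA RC mulmx1.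
  by rewrite !(mulmxA R C) RC !mul1mx.
have [N [UVN NUV]] := invertible_residue A_local pi_m UV1.
have N1 : map_mx pi N = 1%:M.
  by rewrite -[LHS]mul1mx -{1}UV1 -map_mxM UVN map_mx1.
have EV : E *m V = V by rewrite mulmxA EE.
have UE : U *m E = U by rewrite -mulmxA EE.
have VC : map_mx pi V = e *m C by rewrite map_mxM sigmaK.
have UR : map_mx pi U = R *m e by rewrite map_mxM sigmaK.
clearbody V U; exists r, (V *m N), U; split; last by rewrite mulmxA.
pose F := E - V *m N *m U.
have ET : E *m (V *m N *m U) = V *m N *m U by rewrite !mulmxA EV.
have TE : V *m N *m U *m E = V *m N *m U by rewrite -mulmxA UE.
have TT : V *m N *m U *m (V *m N *m U) = V *m N *m U.
  by rewrite -!mulmxA (mulmxA U V) (mulmxA (U *m V)) UVN mul1mx.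
have FF : F *m F = F by rewrite mulmxBr !mulmxBl EE ET TE TT subrr subr0.
(* The defect [F] is an idempotent that vanishes modulo [m]: thus 1 - F is invertible, and F (1 - F)
   = 0 gives F = 0. *)
have [|G [FG _]] := invertible_residue A_local pi_m (M := 1%:M - F).
  rewrite map_mxB map_mx1 /F map_mxB !map_mxM N1 VC UR mulmx1 -/e.
  by rewrite !mulmxA -(mulmxA e C) CR ee ee subrr subr0.
apply/esym/eqP; rewrite -subr_eq0 -/F -[F]mulmx1 -FG mulmxA mulmxBr mulmx1 FF.
by rewrite subrr mul0mx.
Qed.

Lemma mulmx1_size0 n r (U : 'M[A]_(r, n)) (V : 'M[A]_(n, r)) :
  n = 0%N -> U *m V = 1%:M -> r = 0%N.
Proof.
move=> n0; subst n; rewrite thinmx0 mul0mx; case: r U V => // r _ _.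
by move/matrixP/(_ 0 0)/eqP; rewrite !mxE eq_sym oner_eq0.
Qed.

Lemma idempotent_image X (e : chain_map X X) : (forall i, e i *m e i = e i) ->
  exists Y (p : chain_map X Y) (q : chain_map Y X),
    (forall i, p i *m q i = e i) /\ forall i, q i *m p i = 1%:M.
Proof.
move=> ee.
have [r [p [q [pq qp]]]] : exists (r : int -> nat) (p : forall i, 'M[A]_(X i, r i))
    (q : forall i, 'M[A]_(r i, X i)),
    (forall i, p i *m q i = e i) /\ (forall i, q i *m p i = 1%:M).
  have H i := cid (idempotent_mx_split (ee i)).
  have H' i := cid (projT2 (H i)); have H'' i := cid (projT2 (H' i)).
  exists (fun i => projT1 (H i)), (fun i => projT1 (H' i)), (fun i => projT1 (H'' i)).
  by split=> i; have [] := projT2 (H'' i).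
(* The splittings are chosen degree by degree; this differential is the only one for which [p] is a
   chain map. *)
pose d i j := q i *m diff X i j *m p j.
have dshape i j : j != i + 1 -> d i j = 0.
  by move=> ij; rewrite /d diff_shape // mulmx0 mul0mx.
have pd i j : p i *m d i j = diff X i j *m p j.
  by rewrite /d !mulmxA pq cmapP -!mulmxA -pq -mulmxA qp mulmx1.
have dK i j l : d i j *m d j l = 0.
  by rewrite {1}/d -!mulmxA pd (mulmxA (diff X i j)) diffK mul0mx mulmx0.
have rb : exists b : nat, forall i : int, (b < `|i|)%N -> r i = 0%N.
  by have [b Xb] := bounded X; exists b => i /Xb Xi; exact: mulmx1_size0 (qp i).
exists (Complex dshape dK rb).
have dq i j : q i *m diff X i j = d i j *m q j.
  by rewrite /d -mulmxA pq -mulmxA -cmapP mulmxA -pq mulmxA qp mul1mx.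
by exists (@ChainMap _ X (Complex dshape dK rb) p pd),
          (@ChainMap _ (Complex dshape dK rb) X q dq).
Qed.

(** X is the direct sum of the images of [e] and [1 - e], and one of these must be contractible. *)
Lemma indecomposable_idempotent X (e : chain_map X X) : indecomposable X ->
  (forall i, e i *m e i = e i) -> null e \/ null (fun i => 1%:M - e i).
Proof.
move=> [_ X_indec] ee; have eP' i j : (1%:M - e i) *m diff X i j =
    diff X i j *m (1%:M - e j).
  by rewrite mulmxBl mulmxBr mul1mx mulmx1 cmapP.
pose e' := ChainMap eP'.
have e'e' i : e' i *m e' i = e' i.
  by rewrite /= mulmxBr mulmx1 mulmxBl mul1mx ee subrr subr0.
have [Y [p [q [pq qp]]]] := idempotent_image ee.
have [Y' [p' [q' [pq' qp']]]] := idempotent_image e'e'.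
have qp'0 i : q i *m p' i = 0.
  rewrite -[q i]mul1mx -(qp i) -[p' i]mulmx1 -(qp' i) -!mulmxA (mulmxA (p' i)).
  rewrite pq' [p i *m _]mulmxA pq !mulmxA -(mulmxA (q i)) /= mulmxBr ee mulmx1.
  by rewrite subrr mulmx0 mul0mx.
have q'p0 i : q' i *m p i = 0.
  rewrite -[q' i]mul1mx -(qp' i) -[p i]mulmx1 -(qp i) -!mulmxA (mulmxA (p i)).
  rewrite pq [p' i *m _]mulmxA pq' !mulmxA -(mulmxA (q' i)) /= mulmxBl ee mul1mx.
  by rewrite subrr mulmx0 mul0mx.
have fP i j : row_mx (p i) (p' i) *m diff (sum_complex Y Y') i j =
    diff X i j *m row_mx (p j) (p' j).
  by rewrite /= /sum_diff mul_row_block mul_mx_row !mulmx0 addr0 add0r !cmapP.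
have gP i j : col_mx (q i) (q' i) *m diff X i j =
    diff (sum_complex Y Y') i j *m col_mx (q j) (q' j).
  by rewrite /= /sum_diff mul_block_col mul_col_mx !mul0mx addr0 add0r !cmapP.
have iso : isomorphic X (sum_complex Y Y').
  exists (@ChainMap _ X (sum_complex Y Y') _ fP).
  exists (@ChainMap _ (sum_complex Y Y') X _ gP).
  split; apply: eq_null (null0 _ _) => i /=;
    apply/esym/eqP; rewrite subr_eq0; apply/eqP.
    by rewrite mul_row_col pq pq' /= subrKC.
  by rewrite mul_col_row qp qp' qp'0 q'p0 -scalar_mx_block.
have [/isomorphic_zeroP Y0|/isomorphic_zeroP Y0] := X_indec _ _ iso; [left|right].
  have := null_mulr q (null_mull p Y0); apply: eq_null => i.
  by rewrite mulmx1 pq.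
have := null_mulr q' (null_mull p' Y0); apply: eq_null => i.
by rewrite mulmx1 pq'.
Qed.

Lemma map_poly_surj (f : {poly k}) : exists g : {poly A}, map_poly pi g = f.
Proof.
have [sigma sigmaK] := pi_section pi_surj.
exists (\poly_(i < size f) sigma f`_i); apply/polyP => i.
rewrite coef_map coef_poly; case: ltnP => fi; first exact: sigmaK.
by rewrite nth_default //; exact: raddf0.
Qed.

Definition cmap_eval X (e : chain_map X X) (p : {poly A}) : chain_map X X :=
  ChainMap (fun i j => mx_eval_intertwine p (cmapP e i j)).

End Idempotents.

(** * Hensel's lemma and the endomorphisms of an indecomposable complex *)

Section Hensel.
Variables (A : comNzRingType) (m : set A) (A_local : local_ring m).
Variables (k : fieldType) (pi : {rmorphism A -> k}).
Hypothesis pi_m : forall x, pi x = 0 <-> m x.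
Hypothesis pi_surj : forall y, exists x, pi x = y.
Hypothesis hensel : forall (f : {poly A}) (g0 h0 : {poly k}),
  f \is monic -> g0 \is monic -> h0 \is monic -> coprimep g0 h0 ->
  map_poly pi f = g0 * h0 ->
  exists g h : {poly A}, [/\ g \is monic, h \is monic, f = g * h,
    map_poly pi g = g0 & map_poly pi h = h0].
Implicit Types X Y Z : complex A.

(** Cayley-Hamilton in each of the degrees from -b to b, with the product of the characteristic
    polynomials. *)
Lemma annihilating_poly X (e : chain_map X X) :
  exists f : {poly A}, f \is monic /\ forall i, mx_eval (e i) f = 0.
Proof.
have [b Xb] := bounded X.
exists (\prod_(l < (b + b).+1) char_poly (e (l%:Z - b%:Z))); split.
  by apply: monic_prod => l _; exact: char_poly_monic.
move=> i; have [ib|/Xb Xi] := leqP `|i| b; last first.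
  by apply/matrixP => -[c ic]; exfalso; move: ic; rewrite Xi.
have lP : (absz (i + b%:Z)%R < (b + b).+1)%N by lia.
rewrite (bigD1 (Ordinal lP)) //= (_ : Posz (absz (i + b%:Z)%R) - b%:Z = i); last by lia.
by rewrite mx_evalM mx_eval_char_poly mul0mx.
Qed.

(* In the first case [f] lifts a power of T, so that [e] is nilpotent modulo m;
   in the second one [f] is prime to T modulo m, so that [e] is invertible. *)
Lemma indecomposable_endo X (e : chain_map X X) : indecomposable X ->
  (exists f : {poly A}, pi f.[1] = 1 /\ null (cmap_eval e f)) \/
  (exists f : {poly A}, pi f.[0] != 0 /\ null (cmap_eval e f)).
Proof.
move=> X_indec; have [f [f_monic fe]] := annihilating_poly e.
(* Modulo [m], [f] is T^j G with G(0) nonzero: the two factors are coprime, and Hensel's lemma lifts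
   them to [P] and [Q]. *)
have [j [G]] := multiplicity_XsubC (map_poly pi f) 0.
rewrite subr0 monic_neq0 ?monic_map //= => G0 fE.
have G_monic : G \is monic.
  by have := monic_map pi f_monic; rewrite fE monicMr ?monicXn.
have XG : coprimep ('X^j) G.
  by rewrite coprimep_expl // coprimep_sym -['X]subr0 coprimep_XsubC.
have [|P [Q [_ _ fPQ PE QE]]] := hensel f_monic (monicXn k j) G_monic XG.
  by rewrite fE mulrC.
have /Bezout_eq1_coprimepP[[u v] /= uv1] := XG.
have [[U UE] [V VE]] := (map_poly_surj pi_surj u, map_poly_surj pi_surj v).
(* A lifted Bezout relation: [W] is 1 modulo [m], so that its value at [e] is invertible and
   [bezout_idempotent] applies. *)
pose W := U * P + V * Q.
have W1 i : map_mx pi (mx_eval (e i) W) = 1%:M.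
  by rewrite map_mx_eval rmorphD !rmorphM /= UE PE VE QE uv1 mx_evalC.
pose N i := projT1 (cid (invertible_residue A_local pi_m (W1 i))).
have WN i : mx_eval (e i) W *m N i = 1%:M by rewrite /N; case: cid => ? [].
have NW i : N i *m mx_eval (e i) W = 1%:M by rewrite /N; case: cid => ? [].
have NP i l : N i *m diff X i l = diff X i l *m N l.
  rewrite -[LHS]mulmx1 -(WN l) mulmxA -(mulmxA (N i)).
  by rewrite -(cmapP (cmap_eval e W)) [N i *m _]mulmxA NW mul1mx.
pose E := cmap_comp (cmap_eval e (U * P)) (ChainMap NP).
have PQ0 i : mx_eval (e i) (P * Q) = 0 by rewrite -fPQ fe.
have EP i := bezout_idempotent (PQ0 i) (NW i) (WN i).
have [|E0|E0] := indecomposable_idempotent A_local pi_m pi_surj (e := E) X_indec.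
- by move=> i; have [] := EP i.
(* As P(e) = P(e) E, it is null-homotopic with [E]; and [P] reduces to T^j, with value 1 at 1. *)
- left; exists P; split.
    by rewrite -horner_map /= PE rmorph1 hornerXn expr1n.
  by apply: eq_null (null_mull (cmap_eval e P) E0) => i; have [] := EP i.
- right; exists Q; split.
    by rewrite -horner_map /= QE rmorph0.
  by apply: eq_null (null_mull (cmap_eval e Q) E0) => i; have [] := EP i.
Qed.

End Hensel.

(** * Polynomials in an endomorphism, up to homotopy *)

Section EvaluationHomotopy.
Variable A : comNzRingType.
Implicit Types X Y : complex A.

Lemma cmap_scalar_subproof X a i j :
  (a%:M : 'M[A]_(X i)) *m diff X i j = diff X i j *m a%:M.
Proof. by rewrite scalar_mxC. Qed.
Definition cmap_scalar X a : chain_map X X := ChainMap (@cmap_scalar_subproof X a).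

(** All powers of [e] fix [w] up to homotopy, so f(e) acts on it by the sum of the coefficients of
    [f]. *)
Lemma null_eval_fixed X Y (e : chain_map X X) (w : chain_map X Y) (f : {poly A}) :
  null (fun i => w i - e i *m w i) ->
  null (fun i => cmap_eval e f i *m w i - f.[1] *: w i).
Proof.
move=> we; elim/poly_ind: f => [|f c IHf].
  apply: eq_null (null0 X Y) => i /=.
  by rewrite mx_evalC raddf0 mul0mx horner0 scale0r subrr.
apply: eq_null (nullB IHf (null_mull (cmap_eval e f) we)) => i /=.
rewrite mx_evalD mx_evalM mx_evalX mx_evalC !hornerE mulmxDl mul_scalar_mx scalerDl.
rewrite opprD [RHS]addrACA subrr addr0 mulmxBr opprB [LHS]addrC mulmxA.
by rewrite addrA subrK.
Qed.

(** Multiplication by [a] kills all terms of f(e) but the constant one, while f(e) itself is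
    null-homotopic. *)
Lemma null_eval_torsion X (e : chain_map X X) a (f : {poly A}) :
  null (fun i => a *: e i) -> null (cmap_eval e f) ->
  null (fun i => f.[0] *: (a%:M : 'M[A]_(X i))).
Proof.
move=> ae fe; suff ev : null (fun i => a *: cmap_eval e f i - f.[0] *: a%:M).
  by apply: eq_null (nullB (nullZ a fe) ev) => i; rewrite opprB addrC subrK.
elim/poly_ind: f {fe} => [|f c _].
  apply: eq_null (null0 X X) => i.
  by rewrite /= mx_evalC raddf0 horner0 scale0r scaler0 subrr.
apply: eq_null (null_mull (cmap_eval e f) ae) => i /=.
rewrite mx_evalD mx_evalM mx_evalX mx_evalC !hornerE scalerDr -scalemxAr.
by rewrite !scale_scalar_mx (mulrC c) addrK.
Qed.

End EvaluationHomotopy.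

(** * Powers of elements of the maximal ideal that vanish on X *)

Section Main.
Variables (A : comNzRingType) (m : set A) (A_local : local_ring m).
Variables (A_noetherian : noetherian A).
Variables (k : fieldType) (pi : {rmorphism A -> k}).
Hypothesis pi_m : forall x, pi x = 0 <-> m x.
Hypothesis pi_surj : forall y, exists x, pi x = y.
Implicit Types X Y Z N D : complex A.

(** Here [N] plays the part of the shifted first term of the triangle. *)
Lemma right_AR_torsion X N (h : chain_map X N) : ~ null h ->
  (forall D (t : chain_map D X), indecomposable D -> ~ is_iso t ->
     null (fun i => t i *m h i)) ->
  forall a, m a -> exists n, null (fun i => (a ^+ n)%:M : 'M[A]_(X i)).
Proof.
move=> h_n0 h_ar a ma; apply: contrapT => /forallNP a_torsion; apply: h_n0.
suff /boolp.choice[G hG] : forall n, exists g : chain_map X N,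
    null (fun i => h i - a ^+ n *: g i).
  exact: (krull_null A_local A_noetherian (G := G) ma hG).
move=> n; pose t := fiber_proj (cmap_scalar X (a ^+ n)).
have [|g hg] := @fiber_factor _ _ _ (cmap_scalar X (a ^+ n)) _ h; last first.
  by exists g; apply: eq_null hg => i; rewrite /= mul_scalar_mx.
(* The identity of the fiber is inserted so that [decomposition_ind] applies to it. *)
suff : null (fun i => 1%:M *m (t i *m h i)).
  by apply: eq_null => i; rewrite mul1mx.
apply: (decomposition_ind A_local pi_m pi_surj
  (P := fun F => null (fun i => F i *m (t i *m h i)))).
- move=> F G FG Gh.
  have := nullD (null_mulr (cmap_comp h t) FG) Gh; apply: eq_null => i.
  by rewrite /= mulmxBl subrK.
- by apply: eq_null (null0 _ N) => i; rewrite mul0mx.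
- by move=> F G Fh Gh; apply: eq_null (nullD Fh Gh) => i; rewrite mulmxDl.
move=> D p q D_indec.
have [/is_iso_retract [g [_ gtq]]|not_iso] := EM (is_iso (cmap_comp t q)).
  (* If [q] followed by [t] is invertible, then [t] has a section; as a^n kills [t], it is
     null-homotopic on X. *)
  case: (a_torsion n).
  have := nullB (null_mull g (null_mull q (fiber_proj_null (cmap_scalar X (a ^+ n)))))
                (null_mulr (cmap_scalar X (a ^+ n)) gtq).
  apply: eq_null => i; rewrite -/t /= mulmxBl mul1mx opprB addrC.
  by rewrite !mulmxA subrK.
have := null_mull p (h_ar _ _ D_indec not_iso).
by apply: eq_null => i; rewrite /= !mulmxA.
Qed.

Hypothesis hensel : forall (f : {poly A}) (g0 h0 : {poly k}),
  f \is monic -> g0 \is monic -> h0 \is monic -> coprimep g0 h0 ->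
  map_poly pi f = g0 * h0 ->
  exists g h : {poly A}, [/\ g \is monic, h \is monic, f = g * h,
    map_poly pi g = g0 & map_poly pi h = h0].

Lemma left_AR_torsion X N (w : chain_map (shift (-1) X) N) :
  indecomposable X -> ~ null w ->
  (forall D (t : chain_map N D), indecomposable D -> ~ is_iso t ->
     null (fun i => w i *m t i)) ->
  forall a, m a -> exists n, null (fun i => (a ^+ n)%:M : 'M[A]_(X i)).
Proof.
move=> X_indec w_n0 w_ar a ma; set X' := shift (-1) X in w w_n0 w_ar.
have [n [e [ae we]]] : exists n (e : chain_map X' X'),
    null (fun i => a ^+ n *: e i) /\ null (fun i => w i - e i *m w i).
  apply: contrapT => no_e; apply: w_n0.
  suff /boolp.choice[G wG] : forall n, exists g : chain_map X' N,
      null (fun i => w i - a ^+ n *: g i).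
    exact: (krull_null A_local A_noetherian (G := G) ma wG).
  move=> n; pose s := fiber_proj (cmap_scalar X' (a ^+ n)).
  have [sw|sw] := EM (null (cmap_comp w s)).
    have [g wg] := fiber_factor sw.
    by exists g; apply: eq_null wg => i; rewrite /= mul_scalar_mx.
  pose u := cone_inj (cmap_comp w s).
  have [r wr] : exists r : chain_map X' (fiber (cmap_scalar X' (a ^+ n))),
      null (fun i => w i - r i *m cmap_comp w s i).
    apply: cone_factor; rewrite -/u.
    suff : null (fun i => w i *m u i *m 1%:M).
      by apply: eq_null => i; rewrite mulmx1.
    apply: (decomposition_ind A_local pi_m pi_surj
      (P := fun F => null (fun i => w i *m u i *m F i))).
    - move=> F G FG Gw.
      have := nullD (null_mull (cmap_comp u w) FG) Gw; apply: eq_null => i.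
      by rewrite /= mulmxBr subrK.
    - by apply: eq_null (null0 X' _) => i; rewrite mulmx0.
    - by move=> F G Fw Gw; apply: eq_null (nullD Fw Gw) => i; rewrite mulmxDr.
    move=> D p q D_indec.
    have [/is_iso_retract [g [pug _]]|not_iso] := EM (is_iso (cmap_comp p u)).
      (* If [p] splits [u] up to an isomorphism, then [w] restricted along [s] vanishes, since [u]
         kills it; this was excluded. *)
      case: sw.
      have := nullB (null_mulr g (null_mulr p (cone_inj_null (cmap_comp w s))))
                    (null_mull (cmap_comp w s) pug).
      apply: eq_null => i; rewrite -/u [cmap_comp p u i]/(u i *m p i) mulmxBr mulmx1.
      by rewrite opprB addrC !mulmxA subrK.
    have := null_mulr q (w_ar _ _ D_indec not_iso).
    by apply: eq_null => i; rewrite /= !mulmxA.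
  case: no_e; exists n, (cmap_comp s r); split.
    have := null_mull r (fiber_proj_null (cmap_scalar X' (a ^+ n))).
    by apply: eq_null => i; rewrite -/s /= !mul_mx_scalar scalemxAr.
  by apply: eq_null wr => i; rewrite /= mulmxA.
(* Indecomposability is known for X rather than X[-1], so [e] is moved to X. *)
pose e' := ChainMap (unshift_endoP e).
have [[f [f1 fe']]|[f [f0 fe']]] :=
  indecomposable_endo A_local pi_m pi_surj hensel e' X_indec.
  (* Here f(e) is null-homotopic, yet it acts on [w] as the unit f(1); hence [w] vanishes. *)
  case: w_n0; have [|c fc] := unit_residue A_local pi_m (a := f.[1]).
    by rewrite f1 oner_neq0.
  have fe : null (cmap_eval e f).
    by apply: eq_null (null_shift fe') => i; rewrite /= unshift_endoK.
  have := nullZ c (nullB (null_mulr w fe) (null_eval_fixed f we)).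
  apply: eq_null => i.
  by rewrite opprB addrC subrK scalerA mulrC fc scale1r.
have ae' : null (fun i => a ^+ n *: e' i).
  apply: eq_null (unshift_endo_null ae) => i.
  by rewrite /= /unshift_endo -scalemxAr -scalemxAl.
(* Here f(0) is a unit and f(0) a^n is null-homotopic on X. *)
have [c fc] := unit_residue A_local pi_m f0.
exists n; have := nullZ c (null_eval_torsion ae' fe'); apply: eq_null => i.
by rewrite scalerA mulrC fc scale1r.
Qed.

End Main.

Theorem theorem1p6 (A : comNzRingType) (m : set A)
    (A_local : local_ring m) (A_noetherian : noetherian A)
    (A_henselian : henselian m) (X : complex A) :
  (exists (N E : complex A) (f : chain_map N E) (g : chain_map E X)
          (h : chain_map X (shift 1 N)), right_AR_triangle f g h)
  \/ (exists (N E : complex A) (w : chain_map (shift (-1) X) N)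
          (f : chain_map N E) (g : chain_map E X), left_AR_triangle w f g) ->
  finite_length (total_cohomology X).
Proof.
move=> X_AR; apply: (finite_length_cohomology A_local A_noetherian).
have [k [pi [pi_surj pi_m hensel]]] := A_henselian.
case: X_AR => [[N [E [f [g [h [_ _ _ h_n0 h_ar]]]]]]|
               [N [E [w [f [g [_ X_indec _ w_n0 w_ar]]]]]]].
  apply: (right_AR_torsion A_local A_noetherian pi_m pi_surj (h := h)).
    by move=> /homotopic0.
  by move=> D t D_indec /(h_ar _ _ D_indec)/homotopic0.
apply: (left_AR_torsion A_local A_noetherian pi_m pi_surj hensel (w := w)) => //.
  by move=> /homotopic0.
by move=> D t D_indec /(w_ar _ _ D_indec)/homotopic0.
Qed.
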